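(* Let $\lambda=(\lambda_n)_{n=0}^\infty$ be a sequence of positive numbers. Then the following statements are all equivalent: (i) $\mathscr{S}^2(\lambda)$ contains an everywhere locally unbounded function; (ii) the collection of everywhere locally unbounded functions in $\mathscr{S}^2(\lambda)$ is generic in $\mathscr{S}^2(\lambda)$; (iii) $\sum_n \frac{1}{\lambda_n} = + \infty$.
   Context: $\mathbb{T}$ is the unit circle and $m$ is the unit-normalized arc-length measure on $\mathbb{T}$. For a distribution $S$ on $\mathbb{T}$ with Fourier coefficients $\widehat{S}(n)=S(\zeta^{-n})$, $n\in\mathbb{Z}$, set $\|S\|_{\ell^2(\lambda)}=\left(\sum_{n\in\mathbb{Z}}|\widehat{S}(n)|^2\lambda_{|n|}\right)^{1/2}$, and let $\ell^2(\lambda)$ be the space of distributions for which this is finite. $\mathscr{S}^2(\lambda)$ is the (complete) space of functions $f\in\ell^2(\lambda)\cap L^2(\mathbb{T},dm)$ normed by $\|f\|_{\mathscr{S}^2(\lambda)}:=\|f\|_{\ell^2(\lambda)}+\|f\|_{L^2}$. A measurable function $f$ on $\mathbb{T}$ is everywhere locally unbounded if for any arc $I\subset\mathbb{T}$ and any number $M>0$ we have $m(\{\zeta\in I: |f(\zeta)|>M\})>0$. A subset of a metric space $X$ is generic in $X$ if its complement is meager, i.e. a countable union of nowhere dense sets in $X$. *)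

(* Defs.v *)
From HB Require Import structures.
From mathcomp Require Import all_boot all_order all_algebra.
From mathcomp Require Import generic_quotient ring_quotient complex.
From mathcomp Require Import all_classical all_reals all_analysis measurable_realfun.
From mathcomp Require Import ring lra.

Set Implicit Arguments.
Unset Strict Implicit.
Unset Printing Implicit Defensive.

Import Order.TTheory GRing.Theory Num.Theory.
Import numFieldNormedType.Exports.

Local Open Scope classical_set_scope.
Local Open Scope ring_scope.

(* [Rcomplex R] is the field [R[i]] with its real-valued modulus as norm. *)
Local Notation C := Rcomplex.

Section circle.
Variable R : realType.

Definition circle : Type := {z : C R | `|z| == 1}.
HB.instance Definition _ := Choice.on circle.

Lemma norm_expi (t : R) : `|Complex (cos (2 * pi * t)) (sin (2 * pi * t)) : C R| == 1.
Proof. by rewrite /Num.norm/= cos2Dsin2 sqrtr1. Qed.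

(* t |-> e^(2 i pi t), of period 1 *)
Definition expi (t : R) : circle := exist (fun z => `|z| == 1) _ (norm_expi t).

HB.instance Definition _ := isPointed.Build circle (expi 0).

End circle.

Fact circle_display : measure_display. Proof. exact: default_measure_display. Qed.

Section circle_measure.
Variable R : realType.
Local Notation T := (circle R).

(* As [expi] is a continuous, open surjection of the line onto the circle, a
   set is Borel in the circle iff its preimage by [expi] is Borel. *)
Definition circle_measurable : set (set T) :=
  [set A | measurable (@expi R @^-1` A : set (measurableTypeR R))].

Let circle_measurable0 : circle_measurable set0.
Proof. by rewrite /circle_measurable/= preimage_set0. Qed.

Let circle_measurableC A : circle_measurable A -> circle_measurable (~` A).
Proof. by rewrite /circle_measurable/= preimage_setC => /measurableC. Qed.

Let circle_measurable_bigcup (F : (set T)^nat) :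
  (forall i, circle_measurable (F i)) -> circle_measurable (\bigcup_i F i).
Proof. by move=> mF; rewrite /circle_measurable/= preimage_bigcup; exact: bigcupT_measurable. Qed.

HB.instance Definition _ := @isMeasurable.Build circle_display (circle R)
  circle_measurable circle_measurable0 circle_measurableC circle_measurable_bigcup.

Lemma measurable_expi :
  measurable_fun [set: measurableTypeR R] (@expi R : measurableTypeR R -> T).
Proof. by move=> _ A mA; rewrite setTI. Qed.

Definition circle_measure : set T -> \bar R :=
  pushforward (mrestr (@lebesgue_measure R) (measurable_itv `[0%R, 1%R[)) (@expi R).

Let circle_measure0 : circle_measure set0 = 0%E.
Proof. by rewrite /circle_measure /pushforward preimage_set0 measure0. Qed.

Let circle_measure_ge0 A : (0 <= circle_measure A)%E.
Proof. by rewrite /circle_measure/pushforward/mrestr measure_ge0. Qed.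

Let circle_measure_sigma_additive : semi_sigma_additive circle_measure.
Proof.
move=> F mF tF mUF; rewrite /circle_measure /pushforward preimage_bigcup.
apply: measure_semi_sigma_additive.
- exact: mF.
- apply/trivIsetP => i j _ _ ij; rewrite -preimage_setI.
  by move/trivIsetP : tF => /(_ _ _ _ _ ij) ->//; rewrite preimage_set0.
- by rewrite -preimage_bigcup.
Qed.

HB.instance Definition _ := isMeasure.Build _ _ _ circle_measure
  circle_measure0 circle_measure_ge0 circle_measure_sigma_additive.

Let circle_measureT : circle_measure setT = 1%E.
Proof.
rewrite /circle_measure /pushforward /mrestr preimage_setT setTI.
by rewrite lebesgue_measure_itv/= lte_fin ltr01 oppr0 adde0.
Qed.

HB.instance Definition _ :=
  Measure_isProbability.Build _ _ _ circle_measure circle_measureT.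

End circle_measure.
Arguments circle_measure {R}.

Section square_root_triangle.
Variable R : realType.

Lemma sqrt_triangle (a b d : R) : 0 <= a -> 0 <= b ->
  (forall t, 0 < t -> d <= (1 + t) * a + (1 + t^-1) * b) ->
  Num.sqrt d <= Num.sqrt a + Num.sqrt b.
Proof.
move=> a0 b0 H; apply/ler_addgt0Pr => e e0.
set p := Num.sqrt a; set q := Num.sqrt b.
have p0 : 0 <= p by exact: sqrtr_ge0.
have q0 : 0 <= q by exact: sqrtr_ge0.
have aE : a = p ^+ 2 by rewrite sqr_sqrtr.
have bE : b = q ^+ 2 by rewrite sqr_sqrtr.
pose u := p + e / 2; pose v := q + e / 2.
have u0 : 0 < u by rewrite /u; lra.
have v0 : 0 < v by rewrite /v; lra.
have pu : p ^+ 2 <= u ^+ 2 by rewrite ler_sqr ?nnegrE /u; lra.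
have qv : q ^+ 2 <= v ^+ 2 by rewrite ler_sqr ?nnegrE /v; lra.
have t0 : 0 < v / u by rewrite divr_gt0.
have := H _ t0; rewrite aE bE invf_div => dle.
have {}dle : d <= (u + v) ^+ 2.
  apply: (le_trans dle).
  have -> : (u + v) ^+ 2 = (1 + v / u) * u ^+ 2 + (1 + u / v) * v ^+ 2.
    by field; rewrite !gt_eqF.
  by apply: lerD; apply: ler_wpM2l => //; rewrite addr_ge0 ?divr_ge0 ?ltW.
apply: (le_trans (ler_wsqrtr dle)).
by rewrite sqrtr_sqr ger0_norm /u /v; lra.
Qed.

Lemma sqrte_triangle (a b d : \bar R) : (0 <= a)%E -> (0 <= b)%E -> (0 <= d)%E ->
  (forall t : R, (0 < t)%R -> (d <= (1 + t)%:E * a + (1 + t^-1)%:E * b)%E) ->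
  (sqrte d <= sqrte a + sqrte b)%E.
Proof.
move=> a0 b0 d0 H.
case: a a0 H => [a| |//] a0 H; last first.
  by rewrite /= addye ?leey// gt_eqF// (lt_le_trans _ (sqrte_ge0 _)).
case: b b0 H => [b| |//] b0 H; last by rewrite /= ?leey.
case: d d0 H => [d| |//] d0 H; last first.
  by have := H _ ltr01; rewrite -!EFinM -EFinD leye_eq.
rewrite /= -EFinD lee_fin.
by apply: sqrt_triangle => [||t t0]; rewrite -lee_fin//; have := H t t0.
Qed.

End square_root_triangle.

Section esum_scale.
Variables (R : realType) (I : choiceType).
Implicit Types (c : R) (a : I -> \bar R).

Let le_esumZ c a : 0 <= c -> (forall i, (0 <= a i)%E) ->
  (\esum_(i in [set: I]) (c%:E * a i) <= c%:E * \esum_(i in [set: I]) a i)%E.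
Proof.
move=> c0 a0; apply: ge_ereal_sup => _ [X [finX _] <-].
rewrite -ge0_mule_fsumr//; apply: lee_wpmul2l; first by rewrite lee_fin.
by apply: esum_ge; exists X.
Qed.

Lemma esumZ c a : 0 <= c -> (forall i, (0 <= a i)%E) ->
  (\esum_(i in [set: I]) (c%:E * a i) = c%:E * \esum_(i in [set: I]) a i)%E.
Proof.
move=> c0 a0; apply/eqP; rewrite eq_le le_esumZ//=.
have [->|cn0] := eqVneq c 0.
  by rewrite mul0e esum_ge0// => i _; rewrite mul0e.
have cp : 0 < c by rewrite lt_neqAle eq_sym cn0.
rewrite -lee_pdivlMl//.
have := @le_esumZ c^-1 (fun i => c%:E * a i)%E.
rewrite invr_ge0 => /(_ c0) H; apply: le_trans (H _) => [|i].
  by apply: le_esum => i _; rewrite muleA -EFinM mulVf// mul1e.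
by rewrite mule_ge0 ?lee_fin.
Qed.

End esum_scale.

Section circle_functions.
Variable R : realType.
Local Notation T := (circle R).
Local Notation m := (@circle_measure R).
Local Notation normC w := (@Num.norm R (C R) w).
Implicit Types f g : T -> C R.

Definition cmeasurable f :=
  measurable_fun [set: T] (fun z => complex.Re (f z)) /\
  measurable_fun [set: T] (fun z => complex.Im (f z)).

Definition cintegral f : C R :=
  Complex (\int[m]_z complex.Re (f z)) (\int[m]_z complex.Im (f z)).

(* The coefficients of the distribution phi |-> \int f phi dm. *)
Definition fourier_coef f (n : int) : C R :=
  cintegral (fun z => f z * sval z ^ (- n)).

Definition L2norm f : \bar R := 'N[m]_2%:E[(fun z => `|f z|%:E)].

Definition ell2norm (lambda : nat -> {posnum R}) f : \bar R :=
  sqrte (\esum_(n in [set: int])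
    (`|fourier_coef f n| ^+ 2 * (lambda `|n|%N)%:num)%:E).

Lemma normC_sqr (w : C R) : `|w| ^+ 2 = complex.Re w ^+ 2 + complex.Im w ^+ 2.
Proof. by case: w => x y; rewrite /Num.norm/= sqr_sqrtr// addr_ge0 ?sqr_ge0. Qed.

Lemma normC_ge_Re (w : C R) : `|complex.Re w| <= `|w|.
Proof.
rewrite -ler_sqr ?nnegrE// normC_sqr real_normK ?num_real//.
by rewrite lerDl sqr_ge0.
Qed.

Lemma normC_ge_Im (w : C R) : `|complex.Im w| <= `|w|.
Proof.
rewrite -ler_sqr ?nnegrE// normC_sqr real_normK ?num_real//.
by rewrite lerDr sqr_ge0.
Qed.

Lemma normCM (v w : C R) : normC (v * w) = `|v| * `|w|.
Proof. exact: Normc.normcM. Qed.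

Lemma normC1 : normC 1 = 1.
Proof. exact: Normc.normc1. Qed.

Lemma normCV (w : C R) : normC (w^-1) = `|w|^-1.
Proof. exact: Normc.normcV. Qed.

Lemma normCZ (a : R) (w : C R) : normC (a *: w) = `|a| * `|w|.
Proof.
apply/eqP; rewrite -(@eqrXn2 _ 2)// ?mulr_ge0// exprMn !normC_sqr.
by case: w => x y /=; rewrite real_normK ?num_real//; apply/eqP; ring.
Qed.

Lemma normC_eq0 (w : C R) : (`|w| == 0) = (w == 0).
Proof. exact: normr_eq0. Qed.

Lemma norm_circle_exp (z : T) (n : int) : normC (sval z ^ n) = 1.
Proof.
have H k : normC (sval z ^+ k) = 1.
  elim: k => [|k IH]; rewrite ?expr0 ?normC1// exprS normCM IH mulr1.
  exact/eqP/(valP z).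
by case: n => n /=; rewrite /exprz ?normCV H// invr1.
Qed.

Lemma cmeasurable_norm f : cmeasurable f -> measurable_fun [set: T] (fun z => `|f z|).
Proof.
move=> [mr mi].
have -> : (fun z => `|f z|) =
    (fun x => x `^ 2^-1) \o (fun z => complex.Re (f z) ^+ 2 + complex.Im (f z) ^+ 2).
  apply/funext => z /=; rewrite -normC_sqr powR12_sqrt ?sqr_ge0//.
  by rewrite sqrtr_sqr normr_id.
apply: measurableT_comp; first exact: measurable_powR.
by apply: measurable_funD; exact: measurable_funX.
Qed.

Lemma cmeasurableD f g : cmeasurable f -> cmeasurable g -> cmeasurable (f \+ g).
Proof.
move=> [fr fi] [gr gi]; split.
- rewrite (_ : (fun _ => _) = (fun z => complex.Re (f z)) \+ (fun z => complex.Re (g z))).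
    exact: measurable_funD.
  by apply/funext => z /=; case: (f z) (g z) => [? ?] [? ?].
- rewrite (_ : (fun _ => _) = (fun z => complex.Im (f z)) \+ (fun z => complex.Im (g z))).
    exact: measurable_funD.
  by apply/funext => z /=; case: (f z) (g z) => [? ?] [? ?].
Qed.

Lemma cmeasurableZ (a : R) f : cmeasurable f -> cmeasurable (fun z => a *: f z).
Proof.
move=> [fr fi]; split.
- rewrite (_ : (fun _ => _) = (fun z => a * complex.Re (f z))).
    exact: measurable_funM.
  by apply/funext => z /=; case: (f z).
- rewrite (_ : (fun _ => _) = (fun z => a * complex.Im (f z))).
    exact: measurable_funM.
  by apply/funext => z /=; case: (f z).
Qed.

Lemma cmeasurableM f g : cmeasurable f -> cmeasurable g -> cmeasurable (fun z => f z * g z).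
Proof.
move=> [fr fi] [gr gi]; split.
- rewrite (_ : (fun _ => _) = (fun z => complex.Re (f z) * complex.Re (g z)) \-
    (fun z => complex.Im (f z) * complex.Im (g z))).
    by apply: measurable_funB; exact: measurable_funM.
  by apply/funext => z /=; case: (f z) (g z) => [? ?] [? ?].
- rewrite (_ : (fun _ => _) = (fun z => complex.Re (f z) * complex.Im (g z)) \+
    (fun z => complex.Im (f z) * complex.Re (g z))).
    by apply: measurable_funD; exact: measurable_funM.
  by apply/funext => z /=; case: (f z) (g z) => [? ?] [? ?].
Qed.

Lemma measurable_comp_expi (h : T -> R) :
  measurable_fun [set: measurableTypeR R] (fun t => h (expi t)) ->
  measurable_fun [set: T] h.
Proof. by move=> mh _ A mA; have := mh measurableT A mA; rewrite !setTI. Qed.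

Lemma measurable_2pi : measurable_fun [set: R] (fun t : R => 2 * pi * t).
Proof. exact: measurable_funM. Qed.

Lemma cmeasurable_exp (n : int) : cmeasurable (fun z : T => (sval z : C R) ^ n).
Proof.
have m1 : cmeasurable (fun z : T => (sval z : C R)).
  split; apply: measurable_comp_expi => /=.
  - apply: (measurableT_comp _ measurable_2pi).
    by apply: continuous_measurable_fun; exact: continuous_cos.
  - apply: (measurableT_comp _ measurable_2pi).
    by apply: continuous_measurable_fun; exact: continuous_sin.
have H k : cmeasurable (fun z : T => (sval z : C R) ^+ k).
  elim: k => [|k IH].
    by split; under eq_fun do rewrite expr0; exact: measurable_cst.
  rewrite (_ : (fun _ => _) = (fun z : T => (sval z : C R) * sval z ^+ k)).
    exact: cmeasurableM.
  by apply/funext => z; rewrite exprS.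
case: n => n; rewrite /exprz; first exact: H.
have E (z : T) : complex.Re ((sval z : C R) ^+ n.+1) ^+ 2 +
    complex.Im ((sval z : C R) ^+ n.+1) ^+ 2 = 1.
  by rewrite -normC_sqr; have := norm_circle_exp z n.+1; rewrite /exprz => ->; rewrite expr1n.
have [Hr Hi] := H n.+1; split.
- rewrite (_ : (fun _ => _) = (fun z : T => complex.Re ((sval z : C R) ^+ n.+1)))//.
  apply/funext => z; have := E z; case: (_ ^+ n.+1) => x y /= ->.
  by rewrite divr1.
- rewrite (_ : (fun _ => _) = (fun z : T => - complex.Im ((sval z : C R) ^+ n.+1))).
    exact: measurableT_comp.
  apply/funext => z; have := E z; case: (_ ^+ n.+1) => x y /= ->.
  by rewrite divr1.
Qed.

Lemma L2_integrable f : cmeasurable f -> (L2norm f < +oo)%E ->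
  m.-integrable [set: T] (fun z => `|f z|%:E).
Proof.
move=> mf f2.
have : (fun z => `|f z|) \in Lfun m 2%:E.
  by rewrite inE; apply/andP; split; rewrite inE//=; exact: cmeasurable_norm.
move/(Lfun_subset12 (fin_num_measure circle_measure _ measurableT)).
by move/Lfun1_integrable.
Qed.

Lemma integrable_Re_fourier f n : cmeasurable f -> (L2norm f < +oo)%E ->
  m.-integrable [set: T] (fun z => (complex.Re (f z * sval z ^ (- n)))%:E).
Proof.
move=> mf f2; apply: le_integrable (L2_integrable mf f2) => //.
  apply/measurable_EFinP; exact: (cmeasurableM mf (cmeasurable_exp (- n))).1.
move=> z _; rewrite /= lee_fin normr_id (le_trans (normC_ge_Re _))//.
by rewrite normCM norm_circle_exp mulr1.
Qed.

Lemma integrable_Im_fourier f n : cmeasurable f -> (L2norm f < +oo)%E ->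
  m.-integrable [set: T] (fun z => (complex.Im (f z * sval z ^ (- n)))%:E).
Proof.
move=> mf f2; apply: le_integrable (L2_integrable mf f2) => //.
  apply/measurable_EFinP; exact: (cmeasurableM mf (cmeasurable_exp (- n))).2.
move=> z _; rewrite /= lee_fin normr_id (le_trans (normC_ge_Im _))//.
by rewrite normCM norm_circle_exp mulr1.
Qed.

Lemma fourier_coefD f g n : cmeasurable f -> (L2norm f < +oo)%E ->
  cmeasurable g -> (L2norm g < +oo)%E ->
  fourier_coef (f \+ g) n = fourier_coef f n + fourier_coef g n.
Proof.
move=> mf f2 mg g2; rewrite /fourier_coef /cintegral.
rewrite [RHS]/GRing.add/=; congr Complex.
- rewrite -RintegralD//=; [|exact: integrable_Re_fourier..].
  by apply: eq_Rintegral => z _; rewrite /= mulrDl; case: (f z * _) (g z * _) => [? ?] [? ?].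
- rewrite -RintegralD//=; [|exact: integrable_Im_fourier..].
  by apply: eq_Rintegral => z _; rewrite /= mulrDl; case: (f z * _) (g z * _) => [? ?] [? ?].
Qed.

Lemma scaleCAl (a : R) (v w : C R) : (a *: v) * w = a *: (v * w).
Proof.
case: v w => [x y] [x' y']; apply/eqP; rewrite eq_complex/=.
by apply/andP; split; apply/eqP; ring.
Qed.

Lemma fourier_coefZ (a : R) f n : cmeasurable f -> (L2norm f < +oo)%E ->
  fourier_coef (fun z => a *: f z) n = a *: fourier_coef f n.
Proof.
move=> mf f2; rewrite /fourier_coef /cintegral.
rewrite [RHS]/GRing.scale/=; congr Complex.
- rewrite -RintegralZl//=; last exact: integrable_Re_fourier.
  by apply: eq_Rintegral => z _; rewrite scaleCAl; case: (f z * _).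
- rewrite -RintegralZl//=; last exact: integrable_Im_fourier.
  by apply: eq_Rintegral => z _; rewrite scaleCAl; case: (f z * _).
Qed.

Lemma L2norm_ge0 f : (0 <= L2norm f)%E.
Proof. exact: Lnorm_ge0. Qed.

Lemma ell2norm_ge0 lambda f : (0 <= ell2norm lambda f)%E.
Proof. exact: sqrte_ge0. Qed.

Lemma L2normD f g : cmeasurable f -> cmeasurable g ->
  (L2norm (f \+ g)%R <= L2norm f + L2norm g)%E.
Proof.
move=> mf mg; have mfg := cmeasurableD mf mg.
have nf := cmeasurable_norm mf; have ng := cmeasurable_norm mg.
have nfg := cmeasurable_norm mfg.
apply: le_trans (eminkowski circle_measure nf ng _); last by rewrite lee_fin ler1n.
rewrite /L2norm unlock; apply: gt0_ler_poweR; rewrite ?invr_ge0//.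
- by rewrite in_itv/= leey andbT integral_ge0// => z _; exact: poweR_ge0.
- by rewrite in_itv/= leey andbT integral_ge0// => z _; exact: poweR_ge0.
- apply: ge0_le_integral => //=.
  + by apply/measurable_EFinP/(measurableT_comp (measurable_powR _))/measurableT_comp.
  + apply/measurable_EFinP/(measurableT_comp (measurable_powR _))/measurableT_comp => //.
    exact: measurable_funD.
  + move=> z _; rewrite !powR_mulrn// lee_fin !normr_id ler_sqr ?nnegrE//.
    by rewrite (ger0_norm (addr_ge0 _ _))// ler_normD.
Qed.

Lemma L2normZ (a : R) f : cmeasurable f -> (L2norm f < +oo)%E ->
  L2norm (fun z => a *: f z) = (`|a|%:E * L2norm f)%E.
Proof.
move=> mf f2.
have nf := cmeasurable_norm mf.
rewrite /L2norm unlock.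
under eq_integral do rewrite /= normCZ normrM normr_id powRM// EFinM.
rewrite ge0_integralZl_EFin ?powR_ge0//=.
- rewrite poweRM ?integral_ge0 ?lee_fin ?powR_ge0//.
  by rewrite poweR_EFin -powRrM mulfV ?powRr1 ?pnatr_eq0.
- by apply/measurable_EFinP/(measurableT_comp (measurable_powR _))/measurableT_comp.
Qed.

Lemma ell2normD lambda f g : cmeasurable f -> (L2norm f < +oo)%E ->
  cmeasurable g -> (L2norm g < +oo)%E ->
  (ell2norm lambda (f \+ g)%R <= ell2norm lambda f + ell2norm lambda g)%E.
Proof.
move=> mf f2 mg g2; apply: sqrte_triangle.
- by apply: esum_ge0 => n _; rewrite lee_fin mulr_ge0.
- by apply: esum_ge0 => n _; rewrite lee_fin mulr_ge0.
- by apply: esum_ge0 => n _; rewrite lee_fin mulr_ge0.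
move=> t t0.
have t1 : 0 <= 1 + t by rewrite addr_ge0// ltW.
have t2 : 0 <= 1 + t^-1 by rewrite addr_ge0// invr_ge0 ltW.
rewrite -!esumZ//; [|by move=> n; rewrite lee_fin mulr_ge0..].
rewrite -esumD; [|by move=> n _; rewrite lee_fin !mulr_ge0..].
apply: le_esum => n _; rewrite -!EFinM -EFinD lee_fin !mulrA -mulrDl.
apply: ler_wpM2r => //; rewrite fourier_coefD//.
move: (fourier_coef f n) (fourier_coef g n) => v w.
apply: (@le_trans _ _ ((`|v| + `|w|) ^+ 2)).
  by rewrite ler_sqr ?nnegrE ?addr_ge0// ler_normD.
rewrite -subr_ge0.
rewrite (_ : _ - _ = t^-1 * (t * `|v| - `|w|) ^+ 2).
  by rewrite mulr_ge0 ?sqr_ge0// invr_ge0 ltW.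
by field; rewrite gt_eqF.
Qed.

Lemma ell2normZ lambda (a : R) f : cmeasurable f -> (L2norm f < +oo)%E ->
  ell2norm lambda (fun z => a *: f z) = (`|a|%:E * ell2norm lambda f)%E.
Proof.
move=> mf f2; rewrite /ell2norm.
have -> : \esum_(n in [set: int])
    (`|fourier_coef (fun z => a *: f z) n| ^+ 2 * (lambda `|n|%N)%:num)%:E =
  ((`|a| ^+ 2)%:E * \esum_(n in [set: int]) (`|fourier_coef f n| ^+ 2 * (lambda `|n|%N)%:num)%:E)%E.
  rewrite -esumZ ?sqr_ge0//.
  by apply: eq_esum => n _; rewrite fourier_coefZ// normCZ exprMn -mulrA EFinM.
rewrite sqrteM ?lee_fin ?sqr_ge0//=.
by rewrite sqrtr_sqr normr_id.
Qed.

Lemma fourier_coef_ae f g n : cmeasurable f -> cmeasurable g ->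
  {ae m, forall z, f z = g z} -> fourier_coef f n = fourier_coef g n.
Proof.
move=> mf mg fg; rewrite /fourier_coef/cintegral/Rintegral; congr (Complex (fine _) (fine _)).
- apply: ae_eq_integral => //.
  + by apply/measurable_EFinP; exact: (cmeasurableM mf (cmeasurable_exp (- n))).1.
  + by apply/measurable_EFinP; exact: (cmeasurableM mg (cmeasurable_exp (- n))).1.
  + by move: fg; apply: filterS => z /= ->.
- apply: ae_eq_integral => //.
  + by apply/measurable_EFinP; exact: (cmeasurableM mf (cmeasurable_exp (- n))).2.
  + by apply/measurable_EFinP; exact: (cmeasurableM mg (cmeasurable_exp (- n))).2.
  + by move: fg; apply: filterS => z /= ->.
Qed.

Lemma ell2norm_ae lambda f g : cmeasurable f -> cmeasurable g ->
  {ae m, forall z, f z = g z} -> ell2norm lambda f = ell2norm lambda g.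
Proof.
move=> mf mg fg; congr sqrte; apply: eq_esum => n _.
by rewrite (fourier_coef_ae _ mf mg fg).
Qed.

Lemma L2norm_ae f g : cmeasurable f -> cmeasurable g ->
  {ae m, forall z, f z = g z} -> L2norm f = L2norm g.
Proof.
move=> mf mg fg; rewrite /L2norm unlock; congr (_ `^ _)%E.
have nf := cmeasurable_norm mf; have ng := cmeasurable_norm mg.
apply: ae_eq_integral => //=.
- by apply/measurable_EFinP/(measurableT_comp (measurable_powR _))/measurableT_comp.
- by apply/measurable_EFinP/(measurableT_comp (measurable_powR _))/measurableT_comp.
- by move: fg; apply: filterS => z /= ->.
Qed.

Lemma L2norm_eq0 f : cmeasurable f -> L2norm f = 0%E -> {ae m, forall z, f z = 0}.
Proof.
move=> mf /Lnorm_eq0_eq0 H.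
have /measurable_EFinP/H : measurable_fun [set: T] (fun z => `|f z|).
  exact: cmeasurable_norm.
rewrite lte_fin ltr0n => /(_ isT).
by apply: filterS => z /(_ I) [] /eqP; rewrite normC_eq0 => /eqP.
Qed.

Lemma cmeasurable0 : cmeasurable (fun=> 0).
Proof. by split; exact: measurable_cst. Qed.

Lemma L2norm0 : L2norm (fun=> 0) = 0%E.
Proof.
rewrite /L2norm; under [X in Lnorm _ _ X]eq_fun do rewrite normr0.
by rewrite (@Lnorm0 _ _ _ m 2%:E) ?eqe ?pnatr_eq0.
Qed.

Lemma ell2norm0 lambda : ell2norm lambda (fun=> 0) = 0%E.
Proof.
have := @ell2normZ lambda 0 (fun=> 0) cmeasurable0.
rewrite L2norm0 => /(_ (ltry _)).
by under eq_fun do rewrite scaler0; rewrite normr0 mul0e.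
Qed.

End circle_functions.

Section S2.
Variables (R : realType) (lambda : nat -> {posnum R}).
Local Notation T := (circle R).
Local Notation m := (@circle_measure R).

Definition in_S2 : {pred T -> C R} := mem [set f : T -> C R |
  [/\ cmeasurable f, (ell2norm lambda f < +oo)%E & (L2norm f < +oo)%E]].

Lemma in_S2_submod_closed : submod_closed in_S2.
Proof.
split.
  rewrite inE/=; split; [exact: cmeasurable0|by rewrite ell2norm0 ltry|].
  by rewrite L2norm0 ltry.
move=> a f g; rewrite !inE/= => -[mf lf f2] [mg lg g2].
have maf := cmeasurableZ a mf.
have af2 : (L2norm (fun z => a *: f z) < +oo)%E by rewrite L2normZ// lte_mul_pinfty.
have laf : (ell2norm lambda (fun z => a *: f z) < +oo)%E.
  by rewrite ell2normZ// lte_mul_pinfty.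
split.
- exact: cmeasurableD.
- by apply: le_lt_trans (ell2normD lambda maf af2 mg g2) _; rewrite lte_add_pinfty.
- by apply: le_lt_trans (L2normD maf mg) _; rewrite lte_add_pinfty.
Qed.

HB.instance Definition _ :=
  GRing.isSubmodClosed.Build R (T -> C R) in_S2 in_S2_submod_closed.

Record S2fun : Type := S2Fun { S2fun_val :> T -> C R; _ : S2fun_val \in in_S2 }.

HB.instance Definition _ := [isSub for S2fun_val].
HB.instance Definition _ := [Choice of S2fun by <:].
HB.instance Definition _ := [SubChoice_isSubLmodule of S2fun by <:].

Lemma S2funP (f : S2fun) :
  [/\ cmeasurable f, (ell2norm lambda f < +oo)%E & (L2norm f < +oo)%E].
Proof. by have := valP f; rewrite inE. Qed.

Lemma S2funB (f g : S2fun) z : (f - g) z = f z - g z.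
Proof. by []. Qed.

Lemma S2funZ (a : R) (f : S2fun) z : (a *: f) z = a *: f z.
Proof. by []. Qed.

Definition S2null : {pred S2fun} :=
  mem [set f : S2fun | {ae m, forall z, f z = 0}].

Lemma S2null_zmod_closed : zmod_closed S2null.
Proof.
split; first by rewrite inE/=; apply/nearW.
move=> f g; rewrite !inE/= => f0 g0.
by move: f0 g0; apply: filterS2 => z fz gz; apply: etrans (S2funB f g z) _; rewrite fz gz subrr.
Qed.

HB.instance Definition _ :=
  GRing.isZmodClosed.Build S2fun S2null S2null_zmod_closed.

Local Open Scope quotient_scope.

(* Functions are identified when their difference vanishes almost everywhere. *)
Definition S2 : Type := Quotient.quot S2null.
HB.instance Definition _ := GRing.Zmodule.on S2.
HB.instance Definition _ := EqQuotient.on S2.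

(* A representative; only a.e.-invariant properties of it are meaningful. *)
Definition S2_fun (F : S2) : T -> C R := (repr F : S2fun).
Coercion S2_fun : S2 >-> Funclass.

Lemma S2_eqP (f g : S2fun) :
  \pi_S2 f = \pi_S2 g <-> {ae m, forall z, f z = g z}.
Proof.
split=> [/eqP|fg]; last (apply/eqP; move: fg).
  rewrite -Quotient.idealrBE inE/=.
  by apply: filterS => z fg; apply/eqP; rewrite -subr_eq0; apply/eqP; exact: fg.
rewrite -Quotient.idealrBE inE/=.
by apply: filterS => z fg; apply: etrans (S2funB f g z) _; rewrite fg subrr.
Qed.

Lemma S2_piE (f : S2fun) : {ae m, forall z, (\pi_S2 f : S2) z = f z}.
Proof. by apply/S2_eqP; rewrite reprK. Qed.

Definition S2_scale (a : R) (F : S2) : S2 := \pi_S2 (a *: (repr F : S2fun)).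

Lemma S2_scale_pi a (f : S2fun) : S2_scale a (\pi_S2 f) = \pi_S2 (a *: f).
Proof.
apply/S2_eqP; have := S2_piE f; apply: filterS => z.
by rewrite /S2_fun !S2funZ => ->.
Qed.

Lemma S2_piD (f g : S2fun) : \pi_S2 (f + g) = \pi_S2 f + \pi_S2 g :> S2.
Proof. by rewrite !piE. Qed.

Let S2_scaleA a b F : S2_scale a (S2_scale b F) = S2_scale (a * b) F.
Proof. by elim/quotW: F => f; rewrite (S2_scale_pi b) (S2_scale_pi a) S2_scale_pi scalerA. Qed.

Let S2_scale1 : left_id 1 S2_scale.
Proof. by elim/quotW => f; rewrite !S2_scale_pi scale1r. Qed.

Let S2_scaleDr : right_distributive S2_scale +%R.
Proof.
move=> a; elim/quotW => f; elim/quotW => g.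
by rewrite -S2_piD !S2_scale_pi -S2_piD scalerDr.
Qed.

Let S2_scaleDl F : {morph S2_scale^~ F : a b / a + b}.
Proof. by elim/quotW: F => f a b; rewrite !S2_scale_pi -S2_piD scalerDl. Qed.

HB.instance Definition _ := GRing.Zmodule_isLmodule.Build R S2
  S2_scaleA S2_scale1 S2_scaleDr S2_scaleDl.

Definition S2_norm (F : S2) : R := fine (ell2norm lambda F) + fine (L2norm F).

Let S2_norm_pi (f : S2fun) :
  S2_norm (\pi_S2 f) = fine (ell2norm lambda f) + fine (L2norm f).
Proof.
have [mf _ _] := S2funP f; have [mg _ _] := S2funP (repr (\pi_S2 f)).
have H := S2_piE f.
by rewrite /S2_norm (ell2norm_ae _ mg mf H) (L2norm_ae mg mf H).
Qed.

Let S2_ler_normD F G : S2_norm (F + G) <= S2_norm F + S2_norm G.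
Proof.
elim/quotW: F => f; elim/quotW: G => g; rewrite -S2_piD !S2_norm_pi.
have [mf lf f2] := S2funP f; have [mg lg g2] := S2funP g.
have [_ lfg fg2] := S2funP (f + g).
rewrite addrACA -lee_fin !EFinD !fineK ?ge0_fin_numE ?ell2norm_ge0 ?L2norm_ge0//.
by apply: leeD; [exact: ell2normD|exact: L2normD].
Qed.

Let S2_normZ a F : S2_norm (a *: F) = `|a| * S2_norm F.
Proof.
elim/quotW: F => f; rewrite [a *: _]S2_scale_pi !S2_norm_pi.
have [mf lf f2] := S2funP f.
rewrite [ell2norm _ (a *: f)]ell2normZ// [L2norm (a *: f)]L2normZ//.
have fl : ell2norm lambda f \is a fin_num by rewrite ge0_fin_numE ?ell2norm_ge0.
have ff : L2norm f \is a fin_num by rewrite ge0_fin_numE ?L2norm_ge0.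
by rewrite mulrDr; congr (_ + _); exact: (fineM (x := `|a|%:E)).
Qed.

Let S2_norm_eq0 F : S2_norm F = 0 -> F = 0.
Proof.
elim/quotW: F => f; rewrite S2_norm_pi => /eqP.
have [mf lf f2] := S2funP f.
rewrite paddr_eq0 ?fine_ge0 ?ell2norm_ge0 ?L2norm_ge0// => /andP[_].
rewrite fine_eq0 ?ge0_fin_numE ?L2norm_ge0// => /eqP/(L2norm_eq0 mf) f0.
rewrite (_ : 0 = \pi_S2 0); first exact/S2_eqP.
by rewrite !piE.
Qed.

HB.instance Definition _ := Lmodule_isNormed.Build R S2
  S2_ler_normD S2_normZ S2_norm_eq0.

(* The topology of S2 is the one induced by this norm. *)
Lemma S2_normE (F : S2) : `|F| = fine (ell2norm lambda F) + fine (L2norm F).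
Proof. by []. Qed.

End S2.

Section locally_unbounded.
Variable R : realType.
Local Notation T := (circle R).
Local Notation m := (@circle_measure R).

(* Nondegenerate arcs; an arc with b - a > 1 is the whole circle. *)
Definition arc (I : set T) :=
  exists a b : R, a < b /\ I = (@expi R) @` [set` `]a, b[].

Definition everywhere_locally_unbounded (f : T -> C R) :=
  forall (I : set T) (M : R), arc I -> 0 < M ->
    (0 < m (I `&` [set z | (M < `|f z|)%R]))%E.

Lemma expi_shift (s t h : R) : expi s = expi t -> expi (s + h) = expi (t + h).
Proof.
move=> /(congr1 val)/= /eqP; rewrite eq_complex/= => /andP[/eqP cE /eqP sE].
apply: val_inj; apply: (f_equal2 (@Complex R)).
- by rewrite (mulrDr _ s) (mulrDr _ t) !cosD cE sE.
- by rewrite (mulrDr _ s) (mulrDr _ t) !sinD cE sE.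
Qed.

Lemma measurable_arc (I : set T) : arc I -> measurable I.
Proof.
move=> [a [b [ab ->]]]; rewrite /measurable/= /circle_measurable/=.
apply: open_measurable; rewrite openE => s /= [t tab est].
have : nbhs t [set` `]a, b[] by exact: near_in_itvoo.
move=> /nbhs_ballP[e /= e0 H]; apply/nbhs_ballP; exists e => //= s' ss'.
exists (t + (s' - s)).
  by apply: H; move: ss'; rewrite /ball/= opprD addNKr opprB.
by rewrite (expi_shift _ est) addrC subrK.
Qed.

(* Hence the notion makes sense on S2. *)
Lemma everywhere_locally_unbounded_ae (f g : T -> C R) :
  cmeasurable f -> cmeasurable g -> {ae m, forall z, f z = g z} ->
  everywhere_locally_unbounded f -> everywhere_locally_unbounded g.
Proof.
have mU (h : T -> C R) I M : cmeasurable h -> arc I ->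
    measurable (I `&` [set z | M < `|h z|]).
  move=> mh aI; apply: measurableI; first exact: measurable_arc.
  have := cmeasurable_norm mh measurableT (measurable_itv `]M, +oo[).
  rewrite setTI; congr measurable.
  by apply/seteqP; split=> z /=; rewrite in_itv/= andbT.
move=> mf mg [N [mN N0 fgN]] uf I M aI M0.
apply: lt_le_trans (uf I M aI M0) _.
apply: (@le_trans _ _ (m ((I `&` [set z | M < `|g z|]) `|` N))).
  apply: le_measure; rewrite ?inE; [exact: mU|by apply: measurableU => //; exact: mU|].
  move=> z [Iz /= Mf]; have [fgz|fgz] := pselect (f z = g z).
    by left; split => //=; rewrite -fgz.
  by right; exact: fgN.
apply: le_trans (measureU2 _ _ _) _ => //; first exact: mU.
by rewrite -[X in (_ <= X)%E]adde0 -N0.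
Qed.

End locally_unbounded.

Section generic.
Variable X : topologicalType.
Implicit Types A : set X.

Definition nowhere_dense A := interior (closure A) = set0.

Definition meager A := exists2 F : (set X)^nat,
  (forall n, nowhere_dense (F n)) & A = \bigcup_n F n.

Definition generic A := meager (~` A).

End generic.

(* Main.v *)
(* If \sum_n 1 / lambda_n diverges, the polynomials \sum_(n < N) c_n (z / w)^n with
   c_n proportional to 1 / (lambda_n + 1) reach any prescribed value at w while
   their S^2 norm tends to 0. Hence no ball of S^2 consists of limits of
   functions bounded by M on an arc I, and the complement of the everywhere
   locally unbounded functions is a countable union, over rational arcs and
   integer M, of nowhere dense sets.
   If the series converges, the Fourier coefficients of f in S^2 are summable,
   so |\int f P| <= K \int |P| for every Laurent polynomial P. Polynomials in
   sin^2 (pi (t - c)) converge boundedly to indicators of arcs centred at c, so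
   the averages of f over arcs are bounded, and f is essentially bounded by
   Lebesgue's differentiation theorem.
   Finally S^2 is complete, so by Baire's theorem a generic set is nonempty. *)
From mathcomp Require Import generic_quotient complex.
Require Import Defs.
From HB Require Import structures.
From mathcomp Require Import all_boot all_order all_algebra.
From mathcomp Require Import all_classical all_reals all_analysis measurable_realfun.
From mathcomp Require Import ring lra.

Set Implicit Arguments.
Unset Strict Implicit.
Unset Printing Implicit Defensive.

Import Order.TTheory GRing.Theory Num.Theory.
Import numFieldNormedType.Exports.

Local Open Scope classical_set_scope.
Local Open Scope ring_scope.

(** * Integration on the circle *)

(** Summable coefficients make the Fourier series of f converge uniformly, but to bound f itself one
    would have to identify the sum with f, that is, to know that Fourier coefficients determine a
    function. Testing f against Laurent polynomials avoids this: each integral is a finite sum of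
    coefficients, and approximants with values in [0, 1] turn the estimate into one on averages of
    f. The weights [lambda n + 1] in the divergent case arise because the squares of the two norms
    of \sum c_n z^n add up to \sum |c_n|^2 (lambda_n + 1). The series of 1 / (lambda_n + 1) still
    diverges, as terms with lambda_n <= 1 contribute at least 1/2 each. The factors 2 and 4 in the
    estimates come from treating real and imaginary parts separately; only finiteness of the bounds
    matters. *)

Lemma integral_mrestr d (T : measurableType d) (R : realType)
    (mu : {measure set T -> \bar R}) (D : set T) (mD : measurable D)
    (h : T -> \bar R) : measurable_fun setT h ->
  (\int[mrestr mu mD]_x h x = \int[mu]_(x in D) h x)%E.
Proof.
have ge0 (g : T -> \bar R) : measurable_fun setT g -> (forall x, 0 <= g x)%E ->
    (\int[mrestr mu mD]_x g x = \int[mu]_(x in D) g x)%E.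
  move=> mg g0; have mDC : measurable (~` D) by exact: measurableC.
  rewrite (@ge0_negligible_integral _ _ _ (mrestr mu mD) _ (~` D))//=; last first.
    (* The complement of [D] is null for the restricted measure, so it can be removed from the
       domain; on subsets of [D] the two measures agree. *)
    by rewrite [LHS]/mrestr setIC setICr measure0.
  rewrite setDE setCK setTI; apply: (eq_measure_integral mu) => A mA AD.
  by rewrite /= /mrestr setIidl.
move=> mh; rewrite [LHS]integralE [RHS]integralE !ge0//.
- exact: measurable_funeneg.
- exact: measurable_funepos.
Qed.

Section circle_integral.
Variable R : realType.
Local Notation C := (Rcomplex R).
Local Notation T := (circle R).
Local Notation m := (@circle_measure R).
Local Notation mu := (@lebesgue_measure R).
Local Notation normC w := (@Num.norm R C w).

Lemma circle_integralE (h : T -> \bar R) : measurable_fun setT h ->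
  (\int[m]_z h z = \int[mu]_(t in `[0%R, 1%R[) h (expi t))%E.
Proof.
have ge0 (g : T -> \bar R) : measurable_fun setT g -> (forall x, 0 <= g x)%E ->
    (\int[m]_z g z = \int[mu]_(t in `[0%R, 1%R[) g (expi t))%E.
  move=> mg g0; rewrite (ge0_integral_pushforward (@measurable_expi R) _ measurableT)//.
  rewrite preimage_setT integral_mrestr//.
move=> mh; rewrite [LHS]integralE ge0//; last exact: measurable_funepos.
rewrite ge0//; last exact: measurable_funeneg.
rewrite [RHS]integralE; under [in RHS]eq_integral do rewrite (funepos_comp h (@expi R)).
by under [X in (_ = _ - X)%E]eq_integral do rewrite (funeneg_comp h (@expi R)).
Qed.

Lemma expiX (t : R) (n : int) :
  (sval (expi t) : C) ^ n = Complex (cos (2 * pi * (n%:~R * t))) (sin (2 * pi * (n%:~R * t))).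
Proof.
have H (k : nat) : (sval (expi t) : C) ^+ k =
    Complex (cos (2 * pi * (k%:R * t))) (sin (2 * pi * (k%:R * t))).
  elim: k => [|k IH]; first by rewrite expr0 mul0r mulr0 cos0 sin0.
  have -> : 2 * pi * (k.+1%:R * t) = 2 * pi * t + 2 * pi * (k%:R * t).
    by rewrite -natr1; ring.
  rewrite exprS IH cosD sinD.
  by rewrite [LHS]/GRing.mul/=; congr Complex; ring.
case: n => n; first by rewrite /exprz H pmulrn.
rewrite /exprz H NegzE mulrNz mulNr mulrN cosN sinN -pmulrn.
rewrite [LHS]/GRing.inv/=.
by rewrite cos2Dsin2 !divr1.
Qed.

Definition cintegrable (f : T -> C) :=
  cmeasurable f /\ m.-integrable setT (fun z => `|f z|%:E).

Lemma expi1 : sval (expi 1 : T) = 1 :> C.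
Proof.
rewrite /= mulr1 mulr_natl.
by rewrite cos2pi sin2pi.
Qed.

Lemma cintegral_exp (n : int) : cintegral (fun z : T => (sval z : C) ^ n) = (n == 0)%:R :> C.
Proof.
have [->|n0] := eqVneq n 0.
  rewrite /cintegral; under eq_Rintegral do rewrite expr0z.
  under [X in Complex _ X]eq_Rintegral do rewrite expr0z.
  by rewrite /= !Rintegral_cst//= probability_setT mul1r mul0r.
have n0R : 2 * pi * n%:~R != 0 :> R by rewrite !mulf_neq0 ?intr_eq0// gt_eqF ?pi_gt0.
have [mr mi] := cmeasurable_exp R n.
(* The values of cos and sin at 2 pi n are read off from 1 ^ n = 1. *)
have /eqP := expiX 1 n; rewrite expi1 exp1rz mulr1 eq_complex/= => /andP[/eqP c1 /eqP s1].
(* Serves for the pairs (sin, cos) and (- cos, sin): a primitive with equal values at both ends of a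
   period makes the integral vanish. *)
have key (F F' : R -> R) : (forall x : R, is_derive x (1 : R) F (F' x)) -> continuous F' ->
    F (2 * pi * n%:~R) = F 0 ->
    (\int[mu]_(t in `[0%R, 1%R[) (F' (2 * pi * (n%:~R * t)))%:E = 0)%E.
  move=> dF cF' F01.
  have c' : continuous (fun t : R => F' (2 * pi * (n%:~R * t))).
    move=> t; apply: cvg_comp; last exact: cF'.
    by apply: cvgM; [exact: cvg_cst|apply: cvgM; [exact: cvg_cst|exact: cvg_id]].
  rewrite integral_itv_bndo_bndc; last first.
    by apply/measurable_EFinP; exact: measurable_funTS (continuous_measurable_fun c').
  pose G (t : R) := (2 * pi * n%:~R)^-1 * F (2 * pi * n%:~R * t).
  have dG (t : R) : is_derive t 1 G (F' (2 * pi * (n%:~R * t))).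
    have d1 : is_derive t 1 (fun t : R => 2 * pi * n%:~R * t) (2 * pi * n%:~R).
      by apply: is_derive_eq; rewrite /GRing.scale/= mulr1.
    have d2 := is_derive1_comp (dF _) d1.
    have := is_deriveZ (2 * pi * n%:~R)^-1 d2.
    by move/is_derive_eq; apply; rewrite /GRing.scale/= mulrCA mulVf// mulr1 mulrA.
  have cG : continuous G.
    move=> t; apply/differentiable_continuous/derivable1_diffP.
    exact: (@ex_derive _ _ _ _ _ _ _ (dG t)).
  rewrite (@continuous_FTC2 _ _ G)//.
  - by rewrite /G mulr1 mulr0 F01 -EFinB subrr.
  - exact: continuous_subspaceT.
  - split; [by move=> t _; exact: (@ex_derive _ _ _ _ _ _ _ (dG t))|..].
    + exact/cvg_at_right_filter/cG.
    + exact/cvg_at_left_filter/cG.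
  - by move=> t _; rewrite derive1E (@derive_val _ _ _ _ _ _ _ (dG t)).
have s0 : sin (2 * pi * n%:~R) = sin 0 :> R by rewrite -s1 sin0.
have c0 : (- cos) (2 * pi * n%:~R) = (- cos) 0 :> R by rewrite !fctE -c1 cos0.
have ds (x : R) : is_derive x (1 : R) (- cos) (sin x).
  by apply: is_derive_eq; rewrite opprK.
have kc := key _ _ (@is_derive_sin R) (@continuous_cos R) s0.
have ks := key _ _ ds (@continuous_sin R) c0.
rewrite /cintegral/= /Rintegral; congr Complex.
- rewrite circle_integralE; last exact/measurable_EFinP.
  by under eq_integral do rewrite expiX/=; rewrite kc.
- rewrite circle_integralE; last exact/measurable_EFinP.
  by under eq_integral do rewrite expiX/=; rewrite ks.
Qed.
End circle_integral.

(** * Complex integrals and Fourier coefficients of polynomials *)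

Section cintegrable_theory.
Variable R : realType.
Local Notation C := (Rcomplex R).
Local Notation T := (circle R).
Local Notation m := (@circle_measure R).
Local Notation mu := (@lebesgue_measure R).
Local Notation normC w := (@Num.norm R C w).
Implicit Types (f g : T -> C) (c : C).

Lemma ReM_Rcomplex (v w : C) :
  complex.Re (v * w) = complex.Re v * complex.Re w - complex.Im v * complex.Im w.
Proof. by case: v w => [? ?] [? ?]. Qed.

Lemma ImM_Rcomplex (v w : C) :
  complex.Im (v * w) = complex.Re v * complex.Im w + complex.Im v * complex.Re w.
Proof. by case: v w => [? ?] [? ?]. Qed.

Lemma normC_le_ReIm (w : C) : `|w| <= `|complex.Re w| + `|complex.Im w|.
Proof.
rewrite -ler_sqr ?nnegrE ?addr_ge0// normC_sqr sqrrD !real_normK ?num_real//.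
by rewrite addrAC lerDl mulrn_wge0 ?mulr_ge0.
Qed.

Lemma cmeasurable_cst c : cmeasurable (fun _ : T => c).
Proof. by split; exact: measurable_cst. Qed.

Lemma cintegrable_Re f : cintegrable f -> m.-integrable setT (EFin \o (fun z => complex.Re (f z))).
Proof.
move=> [mf i_f]; apply: le_integrable i_f => //; first by apply/measurable_EFinP; exact: mf.1.
by move=> z _ /=; rewrite lee_fin normr_id normC_ge_Re.
Qed.

Lemma cintegrable_Im f : cintegrable f -> m.-integrable setT (EFin \o (fun z => complex.Im (f z))).
Proof.
move=> [mf i_f]; apply: le_integrable i_f => //; first by apply/measurable_EFinP; exact: mf.2.
by move=> z _ /=; rewrite lee_fin normr_id normC_ge_Im.
Qed.

Lemma cintegrable_bounded f (M : R) : cmeasurable f -> (forall z, `|f z| <= M) -> cintegrable f.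
Proof.
move=> mf fM; split=> //.
apply: (@le_integrable _ _ _ m setT measurableT _ (cst M%:E)) => //.
- by apply/measurable_EFinP; exact: cmeasurable_norm.
- move=> z _ /=; rewrite normr_id lee_fin (le_trans (fM z))//.
  exact: ler_norm.
- exact: finite_measure_integrable_cst.
Qed.

Lemma cintegrable_L2 f : cmeasurable f -> (L2norm f < +oo)%E -> cintegrable f.
Proof. by move=> mf f2; split=> //; exact: L2_integrable. Qed.

Lemma cintegrableD f g : cintegrable f -> cintegrable g -> cintegrable (fun z => f z + g z).
Proof.
move=> [mf i_f] [mg ig]; split; first exact: cmeasurableD.
apply: (le_integrable measurableT) (integrableD measurableT i_f ig) => //.
  by apply/measurable_EFinP; apply: cmeasurable_norm; exact: cmeasurableD.
move=> z _ /=; rewrite normr_id lee_fin (ger0_norm (addr_ge0 _ _))//.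
exact: ler_normD.
Qed.

Lemma cintegrableM f g (M : R) : cintegrable f -> cmeasurable g ->
  (forall z, `|g z| <= M) -> cintegrable (fun z => f z * g z).
Proof.
move=> [mf i_f] mg gM; split; first exact: cmeasurableM.
apply: (le_integrable measurableT) (integrableZl measurableT M i_f) => //.
  by apply/measurable_EFinP; apply: cmeasurable_norm; exact: cmeasurableM.
move=> z _ /=; rewrite normr_id normCM lee_fin normrM normr_id mulrC.
by apply: ler_wpM2r => //; rewrite (le_trans (gM z))// ler_norm.
Qed.

Lemma cintegrableZ c f : cintegrable f -> cintegrable (fun z => c * f z).
Proof.
move=> i_f; under eq_fun do rewrite mulrC.
by apply: cintegrableM i_f (cmeasurable_cst c) _ => z; exact: lexx.
Qed.

Lemma cintegrable0 : cintegrable (fun _ : T => 0 : C).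
Proof. by apply: (@cintegrable_bounded _ 0); [exact: cmeasurable_cst|move=> z; rewrite normr0]. Qed.

Lemma cintegrable_sum (I : Type) (s : seq I) (F : I -> T -> C) :
  (forall i, cintegrable (F i)) -> cintegrable (fun z => \sum_(i <- s) F i z).
Proof.
move=> iF; elim: s => [|i s IH].
  by under eq_fun do rewrite big_nil; exact: cintegrable0.
by under eq_fun do rewrite big_cons; exact: cintegrableD.
Qed.

Lemma cintegralD f g : cintegrable f -> cintegrable g ->
  cintegral (fun z => f z + g z) = cintegral f + cintegral g.
Proof.
move=> i_f ig; rewrite /cintegral [RHS]/GRing.add/=; congr Complex.
- rewrite -RintegralD//; [|exact: cintegrable_Re..].
  by apply: eq_Rintegral => z _; case: (f z) (g z) => [? ?] [? ?].
- rewrite -RintegralD//; [|exact: cintegrable_Im..].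
  by apply: eq_Rintegral => z _; case: (f z) (g z) => [? ?] [? ?].
Qed.

Lemma cintegralZ c f : cintegrable f -> cintegral (fun z => c * f z) = c * cintegral f.
Proof.
move=> i_f; have iR := cintegrable_Re i_f; have iI := cintegrable_Im i_f.
have iZ (a : R) (h : T -> R) : m.-integrable setT (EFin \o h) ->
    m.-integrable setT (EFin \o (fun z => a * h z)).
  by move/(integrableZl measurableT a); congr (integrable _ _ _).
rewrite /cintegral; case: c => a b; rewrite [RHS]/GRing.mul/=.
rewrite -!RintegralZl//; congr Complex.
- rewrite -RintegralB//; [|exact: iZ..].
  by apply: eq_Rintegral => z _; case: (f z).
- rewrite -RintegralD//; [|exact: iZ..].
  by apply: eq_Rintegral => z _; case: (f z).
Qed.

Lemma cintegral0 : cintegral (fun _ : T => 0 : C) = 0.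
Proof.
by have := cintegralZ 0 cintegrable0; rewrite !mul0r.
Qed.

Lemma cintegral_sum (I : Type) (s : seq I) (F : I -> T -> C) :
  (forall i, cintegrable (F i)) ->
  cintegral (fun z => \sum_(i <- s) F i z) = \sum_(i <- s) cintegral (F i).
Proof.
move=> iF; elim: s => [|i s IH].
  by under eq_fun do rewrite big_nil; rewrite big_nil cintegral0.
under eq_fun do rewrite big_cons.
by rewrite cintegralD ?big_cons ?IH//; exact: cintegrable_sum.
Qed.

(* The factor 2 comes from bounding both coordinates separately. *)
Lemma norm_cintegral f : cintegrable f ->
  `|cintegral f| <= 2 * \int[m]_z `|f z|.
Proof.
move=> i_f; apply: le_trans (normC_le_ReIm _) _ => /=.
rewrite mulr2n mulrDl mul1r; apply: lerD.
- apply: le_trans (le_normr_Rintegral measurableT (cintegrable_Re i_f)) _.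
  apply: le_Rintegral => //; [|exact: i_f.2|by move=> z _; exact: normC_ge_Re].
  exact: integrable_norm (cintegrable_Re i_f).
- apply: le_trans (le_normr_Rintegral measurableT (cintegrable_Im i_f)) _.
  apply: le_Rintegral => //; [|exact: i_f.2|by move=> z _; exact: normC_ge_Im].
  exact: integrable_norm (cintegrable_Im i_f).
Qed.

Lemma norm_circle (z : T) : normC (sval z) = 1.
Proof. exact/eqP/(valP z). Qed.

Lemma normCX (w : C) n : normC (w ^+ n) = `|w| ^+ n.
Proof. by elim: n => [|n IH]; rewrite ?expr0 ?normC1// !exprS normCM IH. Qed.

Lemma norm_horner_circle (p : {poly C}) (z : T) :
  normC p.[sval z] <= \sum_(i < size p) normC p`_i.
Proof.
rewrite horner_coef; apply: le_trans (ler_norm_sum _ _ _) _.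
by apply: ler_sum => i _; rewrite normCM normCX norm_circle expr1n mulr1.
Qed.

Lemma cmeasurable_horner (p : {poly C}) : cmeasurable (fun z : T => p.[sval z]).
Proof.
elim/poly_ind: p => [|p c IH].
  by under eq_fun do rewrite horner0; exact: cmeasurable_cst.
under eq_fun do rewrite hornerMXaddC.
apply: cmeasurableD; last exact: cmeasurable_cst.
exact: cmeasurableM IH (cmeasurable_exp R 1).
Qed.

Lemma cintegrable_horner (p : {poly C}) : cintegrable (fun z : T => p.[sval z]).
Proof. exact: cintegrable_bounded (cmeasurable_horner p) (norm_horner_circle p). Qed.

Lemma circle_neq0 (z : T) : sval z != 0 :> C.
Proof. by rewrite -normC_eq0 norm_circle oner_eq0. Qed.

Lemma cintegral_Laurent f (p : {poly C}) (n : int) : cintegrable f ->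
  cintegral (fun z => f z * (p.[sval z] * sval z ^ (- n))) =
  \sum_(i < size p) p`_i * fourier_coef f (n - i%:Z).
Proof.
move=> i_f.
have iF (k : int) : cintegrable (fun z => f z * sval z ^ k).
  apply: (@cintegrableM _ _ 1 i_f (cmeasurable_exp R k)) => z.
  by rewrite norm_circle_exp.
rewrite (_ : (fun z => _) = fun z : T => \sum_(i < size p)
    p`_i * (f z * sval z ^ (- (n - i%:Z)))); last first.
  apply/funext => z; rewrite horner_coef mulrA mulr_sumr mulr_suml.
  apply: eq_bigr => i _; rewrite opprB expfzDr ?circle_neq0// -exprnP; ring.
rewrite cintegral_sum => [|i]; last exact/cintegrableZ/iF.
by apply: eq_bigr => i _; rewrite cintegralZ//; exact: iF.
Qed.

(** Expand as in [cintegral_Laurent] with f = 1, whose Fourier coefficients are known by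
    orthogonality of the characters. *)
Lemma cintegral_horner_exp (p : {poly C}) (n : int) :
  cintegral (fun z : T => p.[sval z] * sval z ^ (- n)) =
  if n is Posz k then p`_k else 0.
Proof.
have i1 := cintegrable_bounded (cmeasurable_cst 1) (fun _ => lexx _).
have := @cintegral_Laurent (fun=> 1) p n i1.
under eq_fun do rewrite mul1r.
move=> ->; rewrite /fourier_coef.
under eq_bigr => i _.
  under eq_fun do rewrite mul1r.
  rewrite cintegral_exp oppr_eq0 subr_eq0.
  over.
case: n => n.
- have [np|np] := ltnP n (size p); last first.
    rewrite nth_default// big1// => i _.
    by rewrite eqz_nat gtn_eqF ?mulr0// (leq_trans (ltn_ord i)).
  rewrite (bigD1 (Ordinal np))//= eqxx mulr1 big1 ?addr0// => i.
  by rewrite -val_eqE/= eqz_nat eq_sym => /negPf ->; rewrite mulr0.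
- by rewrite big1// => i _; rewrite mulr0.
Qed.

Lemma fourier_coef_horner (p : {poly C}) (n : int) :
  fourier_coef (fun z : T => p.[sval z]) n = if n is Posz k then p`_k else 0.
Proof. exact: cintegral_horner_exp. Qed.

Lemma L2normE f : L2norm f = sqrte (\int[m]_z (`|f z| ^+ 2)%:E).
Proof.
rewrite /L2norm unlock /= poweR12_sqrt; last first.
  by apply: integral_ge0 => z _; rewrite lee_fin powR_ge0.
by congr sqrte; apply: eq_integral => z _; rewrite normr_id powR_mulrn.
Qed.

End cintegrable_theory.

(** * Norms of polynomials *)

Section horner_norms.
Variable R : realType.
Local Notation C := (Rcomplex R).
Local Notation T := (circle R).
Local Notation m := (@circle_measure R).
Local Notation normC w := (@Num.norm R C w).

Lemma normC_sqrD (w c : C) : normC (w + c) ^+ 2 = normC w ^+ 2 + normC c ^+ 2 +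
  2 * complex.Re (Complex (complex.Re c) (- complex.Im c) * w).
Proof. by rewrite !normC_sqr; case: w c => [x y] [a b] /=; ring. Qed.

Lemma integrable_sqr_horner (q : {poly C}) :
  m.-integrable setT (EFin \o (fun z : T => normC q.[sval z] ^+ 2)).
Proof.
have mq : measurable_fun setT (fun z : T => normC q.[sval z]).
  exact: cmeasurable_norm (cmeasurable_horner q).
pose M := \sum_(i < size q) normC q`_i.
apply: (@le_integrable _ _ _ m setT measurableT _ (EFin \o cst (M ^+ 2))).
- by apply/measurable_EFinP; exact: measurable_funX.
- move=> z _ /=; rewrite !ger0_norm ?sqr_ge0// lee_fin.
  by rewrite ler_sqr ?nnegrE ?sumr_ge0// norm_horner_circle.
- exact: finite_measure_integrable_cst.
Qed.

(** Induction on the form p * X + c: as |z| = 1, the squared modulus is |p|^2 + |c|^2 plus a cross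
    term in z p(z), and z p(z) has mean 0. *)
Lemma horner_parseval (p : {poly C}) N : (size p <= N)%N ->
  \int[m]_z (normC p.[sval z] ^+ 2) = \sum_(i < N) normC p`_i ^+ 2.
Proof.
elim/poly_ind: p N => [|p c IH] N sp.
  rewrite big1; last by move=> i _; rewrite coef0 normr0 expr0n.
  under eq_Rintegral do rewrite horner0 normr0 expr0n/=.
  by rewrite Rintegral_cst//= mul0r.
case: N sp => [|N] sp.
  move: sp; rewrite big_ord0 size_poly_leq0 => /eqP ->.
  under eq_Rintegral do rewrite horner0 normr0 expr0n/=.
  by rewrite Rintegral_cst//= mul0r.
have {}sp : (size p <= N)%N.
  by move: sp; rewrite size_MXaddC; case: ifP => // /andP[/eqP -> _]; rewrite size_poly0.
pose c' : C := Complex (complex.Re c) (- complex.Im c).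
(* Writing z as a power with exponent [- (-1)] exhibits the mean of z p(z) as the coefficient of p
   at -1, which is 0. *)
have i_c : cintegrable (fun z : T => p.[sval z] * sval z ^ (- (-1))).
  apply: (@cintegrableM _ _ _ 1 (cintegrable_horner p) (cmeasurable_exp R _)) => z.
  by rewrite norm_circle_exp.
have E (z : T) : normC (p * 'X + c%:P).[sval z] ^+ 2 =
    (normC p.[sval z] ^+ 2 + normC c ^+ 2) +
    2 * complex.Re (c' * (p.[sval z] * sval z ^ (- (-1)))).
  rewrite hornerMXaddC opprK expr1z.
  have -> : normC p.[sval z] = normC (p.[sval z] * sval z) by rewrite normCM norm_circle mulr1.
  exact: normC_sqrD.
under eq_Rintegral do rewrite E.
rewrite RintegralD//; first last.
- have := integrableZl measurableT 2 (cintegrable_Re (cintegrableZ c' i_c)).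
  by congr (integrable _ _ _).
- have := integrableD measurableT (integrable_sqr_horner p)
    (finite_measure_integrable_cst m (normC c ^+ 2) measurableT).
  by congr (integrable _ _ _).
rewrite RintegralD//; [|exact: integrable_sqr_horner|exact: finite_measure_integrable_cst].
rewrite Rintegral_cst// RintegralZl//; last exact: cintegrable_Re (cintegrableZ c' i_c).
rewrite (_ : fine (m _) = 1); last by rewrite [m _]probability_setT.
rewrite mulr1 (IH N)//.
have -> : \int[m]_z complex.Re (c' * (p.[sval z] * sval z ^ (- (-1)))) = 0.
  transitivity (complex.Re (cintegral (fun z : T => c' * (p.[sval z] * sval z ^ (- (-1))))))=> //.
  by rewrite cintegralZ// cintegral_horner_exp mulr0.
rewrite mulr0 addr0 big_ord_recl addrC; congr (_ + _).
  by rewrite coefD coefMX coefC eqxx add0r.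
by apply: eq_bigr => i _; rewrite coefD coefMX coefC/= addr0.
Qed.

Lemma L2norm_horner (p : {poly C}) N : (size p <= N)%N ->
  L2norm (fun z : T => p.[sval z]) = (Num.sqrt (\sum_(i < N) normC p`_i ^+ 2))%:E.
Proof.
move=> sp; rewrite L2normE -(horner_parseval sp) /Rintegral.
by rewrite -[in LHS](fineK (integrable_fin_num measurableT (integrable_sqr_horner p))).
Qed.

Lemma ell2norm_horner lambda (p : {poly C}) N : (size p <= N)%N ->
  ell2norm lambda (fun z : T => p.[sval z]) =
  (Num.sqrt (\sum_(i < N) normC p`_i ^+ 2 * (lambda i)%:num))%:E.
Proof.
move=> sp; rewrite /ell2norm.
under eq_esum do rewrite fourier_coef_horner.
set F := fun n : int => _.
rewrite (_ : (\esum_(n in [set: int]) F n)%E =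
    (\sum_(i < N) normC p`_i ^+ 2 * (lambda i)%:num)%:E)//.
have F0 n : (0 <= F n)%E by rewrite lee_fin mulr_ge0.
transitivity (\esum_(n in Posz @` `I_N) F n)%E.
  rewrite [RHS]esum_mkcond; apply: eq_esum => n _; case: ifPn => // /negP nN.
  rewrite /F; case: n nN => n nN; last by rewrite normr0 expr0n mul0r.
  rewrite nth_default ?normr0 ?expr0n ?mul0r// leqNgt; apply/negP => nN'.
  by apply: nN; rewrite inE; exists n => //=; exact: leq_trans nN' sp.
rewrite esum_image; last by move=> a b _ _ [].
rewrite esum_fset; [|exact: finite_II|by move=> ? _; exact: F0].
by rewrite -fsbig_ord sumEFin.
Qed.
End horner_norms.

(** * Essential boundedness from summable Fourier coefficients *)

Section Laurent.
Variable R : realType.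
Local Notation C := (Rcomplex R).
Local Notation T := (circle R).
Local Notation m := (@circle_measure R).
Local Notation normC w := (@Num.norm R C w).
Implicit Types (f g P : T -> C) (c t : R).

Definition Laurent P := exists (p : {poly C}) (n : nat),
  forall z, P z = p.[sval z] * sval z ^ (- n%:Z).

Lemma Laurent_onem P : Laurent P -> Laurent (fun z => 1 - P z).
Proof.
move=> [p [n E]]; exists ('X^n - p), n => z.
by rewrite E !hornerE/= mulrBl exprnP -expfzDr ?circle_neq0// subrr expr0z.
Qed.

Lemma LaurentX P k : Laurent P -> Laurent (fun z => P z ^+ k).
Proof.
move=> [p [n E]]; exists (p ^+ k), (n * k)%N => z.
by rewrite E exprMn horner_exp [X in _ * X = _]exprnP exprz_exp mulNr -PoszM.
Qed.

Lemma cmeasurable_Laurent P : Laurent P -> cmeasurable P.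
Proof.
move=> [p [n E]]; rewrite (_ : P = fun z : T => p.[sval z] * sval z ^ (- n%:Z)); last exact/funext.
by apply: cmeasurableM; [exact: cmeasurable_horner|exact: cmeasurable_exp].
Qed.

Lemma Laurent_bounded P : Laurent P -> exists M : R, forall z, `|P z| <= M.
Proof.
move=> [p [n E]]; exists (\sum_(i < size p) normC p`_i) => z.
by rewrite E normCM norm_circle_exp mulr1 norm_horner_circle.
Qed.

(* Each coefficient of P is one of its Fourier coefficients, hence at most
   twice its L^1 norm. *)
Lemma norm_cintegral_Laurent f P (K : R) : cintegrable f -> Laurent P ->
  (forall (n : int) k, \sum_(i < k) `|fourier_coef f (n - i%:Z)| <= K) ->
  `|cintegral (fun z => f z * P z)| <= K * (2 * \int[m]_z `|P z|).
Proof.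
move=> i_f LP fK; have [M PM] := Laurent_bounded LP; have mP := cmeasurable_Laurent LP.
have [p [n E]] := LP.
rewrite (_ : (fun z => f z * P z) =
    fun z : T => f z * (p.[sval z] * sval z ^ (- n%:Z))); last first.
  by apply/funext => z; rewrite E.
rewrite cintegral_Laurent//.
apply: le_trans (ler_norm_sum _ _ _) _.
have p_le i : normC p`_i <= 2 * \int[m]_z `|P z|.
  have <- : cintegral (fun z : T => P z * sval z ^ (n%:Z - i%:Z)) = p`_i.
    rewrite -[RHS](cintegral_horner_exp p i); congr cintegral; apply/funext => z.
    by rewrite E -mulrA -expfzDr ?circle_neq0// addKr.
  have iP : cintegrable (fun z : T => P z * sval z ^ (n%:Z - i%:Z)).
    apply: (@cintegrable_bounded _ _ M); first by apply: cmeasurableM => //; exact: cmeasurable_exp.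
    by move=> z; rewrite normCM norm_circle_exp mulr1.
  apply: le_trans (norm_cintegral iP) _.
  by under eq_Rintegral do rewrite normCM norm_circle_exp mulr1.
apply: (@le_trans _ _ (\sum_(i < size p) `|fourier_coef f (n%:Z - i%:Z)| * (2 * \int[m]_z `|P z|))).
  by apply: ler_sum => i _; rewrite normCM mulrC ler_wpM2l.
rewrite -mulr_suml ler_wpM2r ?fK//.
by rewrite mulr_ge0// Rintegral_ge0.
Qed.

(** A quarter of the squared distance from z to [expi c]. It is a Laurent polynomial in z, and its
    sublevel sets are arcs centred at [expi c]. *)
Definition chord (c : R) (z : T) : R :=
  (1 - complex.Re ((sval z : C) * (sval (expi c))^-1)) / 2.

Lemma chord_expi c t : chord c (expi t) = sin (pi * (t - c)) ^+ 2.
Proof.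
rewrite /chord -[(sval (expi c))^-1]/(sval (expi c) ^ (-1)) expiX ReM_Rcomplex/=.
rewrite mulN1r mulrN cosN sinN.
have -> : cos (2 * pi * t) * cos (2 * pi * c) - sin (2 * pi * t) * - sin (2 * pi * c) =
   cos (pi * (t - c) *+ 2).
  by rewrite mulrN opprK -cosB; congr cos; rewrite -mulr_natl; ring.
by rewrite cos_mulr2n cos2sin2; field.
Qed.

Lemma chord_ge0 c z : 0 <= chord c z.
Proof.
rewrite divr_ge0// subr_ge0.
apply: le_trans (ler_norm _) _; apply: le_trans (normC_ge_Re _) _.
by rewrite normCM normCV !norm_circle invr1 mulr1.
Qed.

Lemma chord_le1 c z : chord c z <= 1.
Proof.
rewrite ler_pdivrMr// mul1r; suff : -1 <= complex.Re ((sval z : C) * (sval (expi c))^-1) by lra.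
have : `|complex.Re ((sval z : C) * (sval (expi c))^-1)| <= 1.
  by apply: le_trans (normC_ge_Re _) _; rewrite normCM normCV !norm_circle invr1 mulr1.
by rewrite ler_norml => /andP[].
Qed.

Lemma Laurent_chord c : Laurent (fun z => Complex (chord c z) 0).
Proof.
pose w : C := sval (expi c); pose q : C := Complex (4^-1) 0.
(* On the circle Re (z / w) = (z / w + w / z) / 2, so [chord] is (2 - z / w - w / z) / 4; one factor
   z clears the denominator. *)
exists (q *: (2 *: 'X - w^-1 *: 'X^2 - w%:P)), 1%N => z.
rewrite !hornerE/=.
have z0 := circle_neq0 z.
have -> : q * (2 * sval z - w^-1 * sval z * sval z - w) * sval z ^ (- 1%:Z) =
   q * (2 - w^-1 * sval z - w * (sval z)^-1).
  rewrite -[_ ^ (- 1%:Z)]/((sval z)^-1) -mulrA; congr (_ * _).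
  by rewrite !mulrBl -!mulrA mulfV// !mulr1.
rewrite /chord -/w.
have inv (v : T) : (sval v : C)^-1 = Complex (complex.Re (sval v)) (- complex.Im (sval v)).
  have := norm_circle v; case: (sval v) => a b /(congr1 (fun x => x ^+ 2)).
  rewrite normC_sqr expr1n/= => ab1.
  by rewrite [LHS]/GRing.inv/= ab1 !divr1.
rewrite /w !inv; case: (sval z) (sval (expi c)) => a b [a' b'].
by apply/eqP; rewrite eq_complex/=; apply/andP; split; apply/eqP; field.
Qed.

End Laurent.

(** * Polynomials approximating an indicator function *)

Section step_function.
Variable R : realType.
Implicit Types (theta u : R).

(* By Bernoulli's inequality these polynomials tend, pointwise on
   [0, theta[ U ]theta, 1], to the indicator function of [0, theta[. *)
Definition step theta n u : R := (1 - u ^+ n) ^+ Num.truncn (theta^-1 ^+ n).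

Lemma step_ge0 theta n u : 0 <= u <= 1 -> 0 <= step theta n u.
Proof. by move=> /andP[u0 u1]; rewrite exprn_ge0// subr_ge0 exprn_ile1. Qed.

Lemma step_le1 theta n u : 0 <= u <= 1 -> step theta n u <= 1.
Proof.
move=> /andP[u0 u1]; rewrite exprn_ile1// ?subr_ge0 ?exprn_ile1//.
by rewrite gerBl exprn_ge0.
Qed.

Lemma bernoulli_sub (x : R) k : 0 <= x <= 1 -> 1 - k%:R * x <= (1 - x) ^+ k.
Proof.
move=> /andP[x0 x1]; elim: k => [|k IH]; first by rewrite expr0 mul0r subr0.
rewrite exprS -natr1.
have : (1 - x) * (1 - k%:R * x) <= (1 - x) * (1 - x) ^+ k by rewrite ler_wpM2l// subr_ge0.
apply: le_trans; have : 0 <= k%:R * x * x by rewrite !mulr_ge0.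
lra.
Qed.

Lemma bernoulli_add (x : R) k : 0 <= x -> 1 + k%:R * x <= (1 + x) ^+ k.
Proof.
move=> x0; elim: k => [|k IH]; first by rewrite expr0 mul0r addr0.
rewrite exprS -natr1.
have : (1 + x) * (1 + k%:R * x) <= (1 + x) * (1 + x) ^+ k by rewrite ler_wpM2l// addr_ge0.
apply: le_trans; have : 0 <= k%:R * x * x by rewrite !mulr_ge0.
lra.
Qed.

(** The exponent k is at most theta^-n, so Bernoulli bounds [step] below by 1 - k u^n >= 1 - (u /
    theta)^n. *)
Lemma cvg_step_lt theta u : 0 < theta -> theta < 1 -> 0 <= u < theta ->
  step theta n u @[n --> \oo] --> (1 : R).
Proof.
move=> t0 t1 /andP[u0 ut]; have u1 : 0 <= u <= 1 by rewrite u0 ltW// (lt_trans ut).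
apply: (@squeeze_cvgr _ _ _ _ (fun n => 1 - (u / theta) ^+ n) (cst 1)); last exact: cvg_cst.
  apply: nearW => n; rewrite step_le1// andbT /step.
  apply: le_trans (bernoulli_sub _ _); last by case/andP: u1 => ? ?; rewrite exprn_ge0 ?exprn_ile1.
  rewrite lerD2l lerN2 exprMn mulrC ler_wpM2l ?exprn_ge0//.
  by rewrite truncn_le// exprn_ge0// invr_ge0 ltW.
rewrite -[X in _ --> X]subr0; apply: cvgB; first exact: cvg_cst.
apply: cvg_expr; rewrite ger0_norm ?divr_ge0// ?ltW//.
by rewrite ltr_pdivrMr// mul1r.
Qed.

(** With x = u^n, (1 - x)^k (1 + x)^k <= 1, while (1 + x)^k >= 1 + k x >= (u / theta)^n; hence
    [step] is at most (theta / u)^n. *)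
Lemma cvg_step_gt theta u : 0 < theta -> theta < u <= 1 ->
  step theta n u @[n --> \oo] --> (0 : R).
Proof.
move=> t0 /andP[tu u1]; have u0 : 0 < u by exact: lt_trans tu.
have u01 : 0 <= u <= 1 by rewrite (ltW u0).
apply: (@squeeze_cvgr _ _ _ _ (cst 0) (fun n => (theta / u) ^+ n)); [|exact: cvg_cst|].
  apply: nearW => n; rewrite step_ge0//= /step.
  set x := u ^+ n; set k := Num.truncn _.
  have x01 : 0 <= x <= 1 by rewrite exprn_ge0 ?exprn_ile1 ?(ltW u0).
  have [x0 x1] := andP x01.
  have xp : 0 < x by rewrite exprn_gt0.
  have A : (1 - x) ^+ k * (1 + x) ^+ k <= 1.
    rewrite -exprMn exprn_ile1//; last first.
      by rewrite (_ : _ * _ = 1 - x ^+ 2); [rewrite gerBl sqr_ge0|ring].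
    by rewrite mulr_ge0// ?subr_ge0// addr_ge0.
  have B : x / theta ^+ n <= (1 + x) ^+ k.
    apply: le_trans (bernoulli_add _ x0).
    (* Truncation loses at most 1; multiplied by x <= 1, this loss is absorbed by the constant term
       of Bernoulli's bound. *)
    have kt : theta^-1 ^+ n <= k%:R + 1.
      by rewrite natr1 ltW// truncnS_gt.
    rewrite -exprVn mulrC; apply: le_trans (ler_wpM2r x0 kt) _.
    by rewrite mulrDl mul1r addrC lerD2r.
  have xt : 0 < x / theta ^+ n by rewrite divr_gt0// exprn_gt0.
  rewrite expr_div_n -/x -[leRHS]mul1r -(invf_div x) ler_pdivlMr//.
  apply: le_trans A; rewrite ler_wpM2l// exprn_ge0// subr_ge0//.
apply: cvg_expr; rewrite ger0_norm ?divr_ge0// ?ltW//.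
by rewrite ltr_pdivrMr// mul1r.
Qed.

Lemma sin_sqr_le1 (x : R) : sin x ^+ 2 <= 1.
Proof. by have := cos2Dsin2 x; have := sqr_ge0 (cos x); lra. Qed.

(** The difference of the two squares is sin (pi (a + b)) sin (pi (b - a)), and both angles lie in
    ]0, pi[. *)
Lemma sin_sqr_lt (a b : R) : 0 <= a -> a < b -> a + b < 1 ->
  sin (pi * a) ^+ 2 < sin (pi * b) ^+ 2.
Proof.
move=> a0 ab ab1.
have -> : sin (pi * b) ^+ 2 = sin (pi * a) ^+ 2 + sin (pi * (a + b)) * sin (pi * (b - a)).
  rewrite mulrDr mulrBr sinB sinD -[LHS]mulr1 -[in RHS](mulr1 (_ ^+ 2)).
  rewrite -[in LHS](cos2Dsin2 (pi * a)) -[in RHS](cos2Dsin2 (pi * b)); ring.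
rewrite ltrDl mulr_gt0// sin_gt0_pi// ?mulr_gt0 ?pi_gt0 ?subr_gt0 ?gtr_pMr ?pi_gt0//=; lra.
Qed.

End step_function.

Lemma cvg_Rintegral_indic d (T : measurableType d) (R : realType)
    (mu : {measure set T -> \bar R}) (D B : set T) (h : T -> R) (s : nat -> T -> R) :
  measurable D -> measurable B -> mu.-integrable D (EFin \o h) ->
  (forall n, measurable_fun D (s n)) -> (forall n x, D x -> `|s n x| <= 1) ->
  {ae mu, forall x, D x -> s n x @[n --> \oo] --> (\1_B x : R)} ->
  \int[mu]_(x in D) (h x * s n x) @[n --> \oo] --> \int[mu]_(x in D `&` B) h x.
Proof.
move=> mD mB ih ms s1 sB.
have mh : measurable_fun D h by apply/measurable_EFinP; exact: measurable_int ih.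
have mhs n : measurable_fun D (fun x => (h x * s n x)%:E).
  by apply/measurable_EFinP; exact: measurable_funM.
have mhB : measurable_fun D (fun x => (h x * \1_B x)%:E).
  by apply/measurable_EFinP; apply: measurable_funM => //; exact: measurable_indic.
have cv : {ae mu, forall x, D x -> (h x * s n x)%:E @[n --> \oo] --> (h x * \1_B x)%:E}.
  apply: filterS sB => x sx Dx; apply: cvg_EFin; first exact: nearW.
  by apply: cvgM; [exact: cvg_cst|exact: sx].
have bd : {ae mu, forall x n, D x -> (`|(h x * s n x)%:E| <= `|h x|%:E)%E}.
  by apply: nearW => x n Dx; rewrite lee_fin normrM ler_piMr// s1.
have [iB _ H] := dominated_convergence mD mhs mhB cv (integrable_norm ih) bd.
rewrite Rintegral_mkcondr (_ : \int[mu]_(x in D) (h \_ B) x = \int[mu]_(x in D) (h x * \1_B x)).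
  apply: fine_cvg; rewrite fineK//; exact: integrable_fin_num.
by apply: eq_Rintegral => x _; rewrite patchE indicE; case: ifP => _; rewrite ?mulr1 ?mulr0.
Qed.

(** * From averages over arcs to an essential bound *)

Section ae_bound.
Variable R : realType.
Local Notation C := (Rcomplex R).
Local Notation T := (circle R).
Local Notation m := (@circle_measure R).
Local Notation mu := (@lebesgue_measure R).
Implicit Types (h : T -> R) (c r theta : R).

Lemma circle_RintegralE h : measurable_fun setT h ->
  \int[m]_z h z = \int[mu]_(t in `[0, 1[) h (expi t).
Proof. by move=> mh; rewrite /Rintegral circle_integralE//; exact/measurable_EFinP. Qed.

Lemma measurable_lift h : measurable_fun setT h ->
  measurable_fun setT (fun t : R => h (expi t)).
Proof. by move=> mh; apply: measurableT_comp mh _; exact: measurable_expi. Qed.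

Lemma integrable_lift h : m.-integrable setT (EFin \o h) ->
  mu.-integrable `[0, 1[ (EFin \o (fun t => h (expi t))).
Proof.
move=> /integrableP[/measurable_EFinP mh fin]; apply/integrableP; split.
  by apply/measurable_EFinP; exact: measurable_funTS (measurable_lift mh).
apply: le_lt_trans fin; rewrite circle_integralE//.
by apply/measurable_EFinP; exact: measurableT_comp.
Qed.

Lemma measurable_chord c : measurable_fun setT (chord c).
Proof. exact: (cmeasurable_Laurent (Laurent_chord c)).1. Qed.

Lemma measurable_step_chord theta n c : measurable_fun setT (fun z => step theta n (chord c z)).
Proof.
apply: measurable_funX; apply: measurable_funB => //.
by apply: measurable_funX; exact: measurable_chord.
Qed.

(** This is what the limit argument takes from the bound on Fourier coefficients. It concerns real
    functions, since Re f and Im f are treated in turn. *)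
Definition step_bounded h (K : R) := forall c theta n,
  `|\int[m]_z (h z * step theta n (chord c z))| <= K * \int[m]_z step theta n (chord c z).

(** The threshold sin^2 (pi r) is the value of [chord] at distance r from c. The position of c gives
    |t - c| + r < 1, so [sin_sqr_lt] compares the two without wrapping around the circle. *)
Lemma cvg_step_chord r c t : 0 < r -> r < 2^-1 -> r < c -> c < 1 - r ->
  0 <= t < 1 -> t != c - r -> t != c + r ->
  step (sin (pi * r) ^+ 2) n (chord c (expi t)) @[n --> \oo] --> (\1_(ball c r) t : R).
Proof.
move=> r0 r2 rc cr /andP[t0 t1] tl tr.
have th0 : 0 < sin (pi * r) ^+ 2.
  by rewrite exprn_gt0// sin_gt0_pi// mulr_gt0 ?pi_gt0//= gtr_pMr ?pi_gt0//; lra.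
have th1 : sin (pi * r) ^+ 2 < 1.
  apply: (@lt_le_trans _ _ (sin (pi * 2^-1) ^+ 2)); first by apply: sin_sqr_lt; lra.
  exact: sin_sqr_le1.
rewrite chord_expi.
have -> : sin (pi * (t - c)) ^+ 2 = sin (pi * `|t - c|) ^+ 2.
  by case: (ger0P (t - c)) => // _; rewrite mulrN sinN sqrrN.
rewrite indicE; have [tc|tc] := ltP `|t - c| r.
- rewrite mem_set; last by rewrite /ball/= distrC.
  by apply: cvg_step_lt => //; rewrite sqr_ge0 sin_sqr_lt//; lra.
- rewrite memNset; last by rewrite /ball/= distrC; apply/negP; rewrite -leNgt.
  apply: cvg_step_gt => //; apply/andP; split.
    apply: sin_sqr_lt; first exact: ltW.
      rewrite lt_neqAle tc andbT; apply/eqP => rE.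
      by move: tl tr; case: (ger0P (t - c)) rE => _ rE; lra.
    by case: (ger0P (t - c)) => _; lra.
  exact: sin_sqr_le1.
Qed.

Lemma ball_average_bound h K c r : step_bounded h K -> m.-integrable setT (EFin \o h) ->
  0 < r -> r < 2^-1 -> r < c -> c < 1 - r ->
  `|\int[mu]_(t in ball c r) h (expi t)| <= K * (r *+ 2).
Proof.
move=> hK ih r0 r2 rc cr.
pose s n (t : R) := step (sin (pi * r) ^+ 2) n (chord c (expi t)).
have s01 n t : 0 <= s n t <= 1.
  by rewrite /s step_ge0 ?step_le1 ?chord_ge0 ?chord_le1.
pose I01 : set (measurableTypeR R) := `[0%R, 1%R[%classic.
have ms n : measurable_fun I01 (s n).
  exact: measurable_funTS (measurable_lift (measurable_step_chord _ _ _)).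
have s1 n x : I01 x -> `|s n x| <= 1.
  by move=> _; case/andP: (s01 n x) => ? ?; rewrite ger0_norm.
have scv : {ae mu, forall x, I01 x -> s n x @[n --> \oo] --> (\1_(ball c r) x : R)}.
  (* At the two ends of the ball [chord] equals the threshold, where no limit is claimed. *)
  exists [set c - r; c + r]; split.
  - by apply: measurableU; exact: measurable_set1.
  - apply: countable_lebesgue_measure0; exact/finite_set_countable/finite_set2.
  - move=> x /= /not_implyP[]; rewrite /I01/= in_itv/= => x01 nx.
    apply: contrapT => /not_orP[/eqP xl /eqP xr]; apply: nx.
    exact: cvg_step_chord.
have bsub : I01 `&` ball c r = ball c r.
  apply/setIidPr => x; rewrite /ball/I01/= in_itv/= ltr_norml => /andP[? ?]; lra.
have mb : measurable (ball c r : set R) by exact: measurable_ball.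
have m01 : measurable I01 by exact: measurable_itv.
have := @cvg_Rintegral_indic _ _ _ mu I01 (ball c r) _ s m01 mb (integrable_lift ih) ms s1 scv.
rewrite bsub => cvh.
(* The same limit with the constant 1 in place of h turns the right-hand side of [step_bounded] into
   K times the length of the ball. *)
have i1 : mu.-integrable I01 (EFin \o cst (1:R)).
  have := integrable_lift (finite_measure_integrable_cst m 1 measurableT).
  by congr (integrable _ _ _).
have := @cvg_Rintegral_indic _ _ _ mu I01 (ball c r) _ s m01 mb i1 ms s1 scv.
rewrite bsub (_ : \int[mu]_(x in ball c r) _ = r *+ 2) => [cv1|]; last first.
  by rewrite Rintegral_cst// mul1r [X in fine X](lebesgue_measure_ball c (ltW r0)).
have cvK : K * \int[mu]_(x in I01) (cst 1 x * s n x) @[n --> \oo] --> K * (r *+ 2).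
  by apply: cvgM; [exact: cvg_cst|exact: cv1].
apply: (ler_cvg_to (cvg_norm cvh) cvK).
apply: nearW => n; have := hK c (sin (pi * r) ^+ 2) n.
have mh : measurable_fun setT h by apply/measurable_EFinP; exact: measurable_int ih.
rewrite !circle_RintegralE//; [|exact: measurable_step_chord|].
  by under [X in _ -> _ <= K * X]eq_Rintegral do rewrite mul1r.
by apply: measurable_funM => //; exact: measurable_step_chord.
Qed.

Lemma ae_bound h K : step_bounded h K -> m.-integrable setT (EFin \o h) ->
  {ae m, forall z, `|h z| <= K}.
Proof.
move=> hK ih.
have mh : measurable_fun setT h by apply/measurable_EFinP; exact: measurable_int ih.
pose I01 : set (measurableTypeR R) := `[0%R, 1%R[%classic.
have m01 : measurable I01 by exact: measurable_itv.
(* Differentiation takes place on the line, where cutting the periodic lift down to one period makes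
   it integrable. *)
pose g := (fun t => h (expi t)) \_ I01.
have locg : locally_integrable setT g.
  exact: integrable_locally_restrict m01 (integrable_lift ih).
pose E (x : R) n := ball x n.+1%:R^-1 : set (measurableTypeR R).
have niceE x : nicely_shrinking x (E x).
  split; first by move=> n; exact: measurable_ball.
  exists (1, fun n => n.+1%:R^-1%:pos); split => //=.
  - exact: cvg_harmonic.
  - by move=> n y.
  - by move=> n; rewrite mul1e.
have gK x : 0 < x < 1 -> lebesgue_pt g x -> `|g x| <= K.
  move=> /andP[x0 x1] gx; have x1' : 0 < 1 - x by rewrite subr_gt0.
  have small e : 0 < e -> \forall n \near \oo, n.+1%:R^-1 < e :> R.
    by move=> e0; exact: (near_infty_natSinv_lt (PosNum e0)).
  have /fine_cvgP[_ /cvg_norm cv] := nice_lebesgue_differentiation niceE locg gx.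
  apply: cvgr_to_le cv _; near=> n => /=.
  have r2 : n.+1%:R^-1 < 2^-1 :> R by near: n; exact: small.
  have rx : n.+1%:R^-1 < x by near: n; exact: small.
  have rx1 : n.+1%:R^-1 < 1 - x :> R by near: n; exact: small.
  pose r : R := n.+1%:R^-1.
  have r0 : 0 < r by rewrite invr_gt0.
  rewrite -/r in r2 rx rx1.
  have -> : (\int[mu]_(y in E x n) (g y)%:E = \int[mu]_(y in E x n) (h (expi y))%:E)%E.
    apply: eq_integral => y; rewrite inE /E /ball/= -/r ltr_norml => /andP[? ?].
    by rewrite /g patchE mem_set// /I01/= in_itv/=; lra.
  have mE : mu (E x n) = (r *+ 2)%:E by rewrite lebesgue_measure_ball// ltW.
  have xr : x < 1 - r by lra.
  have EI : E x n `<=` I01.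
    by move=> y; rewrite /E /ball/= -/r ltr_norml /I01/= in_itv/= => /andP[? ?]; lra.
  have r20 : 0 < r *+ 2 by rewrite pmulrn_rgt0.
  have := ball_average_bound hK ih r0 r2 rx xr.
  rewrite mE inver (gt_eqF r20) -[(\int[mu]_(y in E x n) _)%E]fineK; last first.
    have mb : measurable (E x n) by exact: measurable_ball.
    have iE := @integrableS _ _ _ mu I01 (E x n) _ m01 mb EI (integrable_lift ih).
    exact: (@integrable_fin_num _ _ _ mu (E x n) mb _ iE).
  rewrite -EFinM/= => H.
  rewrite normrM [X in X * _]gtr0_norm ?invr_gt0// ler_pdivrMl// mulrC.
  exact: H.
have mN : measurable [set z | K < `|h z|].
  have := (measurableT_comp (@normr_measurable R setT) mh) measurableT _ (measurable_itv `]K, +oo[).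
  rewrite setTI; congr measurable.
  by apply/seteqP; split=> z /=; rewrite in_itv/= andbT.
exists [set z | K < `|h z|]; split => //; last by move=> z /= /negP; rewrite -ltNge.
have [N [mN' N0 sN]] := lebesgue_differentiation locg.
(* No ball around 0 fits into [I01], so this point joins the exceptional set. *)
have N00 : mu (N `|` [set 0]) = 0%E.
  by rewrite measureU0//; exact: lebesgue_measure_set1.
apply/eqP; rewrite -measure_le0 -N00; apply: le_measure; rewrite ?inE.
- by apply: measurableI => //; exact: mN.
- exact: measurableU.
move=> t [/= Kt]; rewrite /= in_itv/= => /andP[t0 t1].
have [->|tn0] := eqVneq t 0; [by right|left].
apply: sN => /= ft; move: Kt; apply/negP; rewrite -leNgt.
have tp : 0 < t by rewrite lt_neqAle eq_sym tn0.
have := gK t _ ft; rewrite tp t1 => /(_ isT).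
by rewrite /g patchE mem_set// /I01/= in_itv/= t0.
Unshelve. all: by end_near. Qed.
End ae_bound.

(** * Convergent series: summable coefficients and boundedness *)

Section Fourier_bound.
Variable R : realType.
Local Notation C := (Rcomplex R).
Local Notation T := (circle R).
Local Notation m := (@circle_measure R).
Implicit Types (f : T -> C) (K : R).

Lemma Laurent_step theta n (c : R) : Laurent (fun z => Complex (step theta n (chord c z)) 0).
Proof.
have cX (x : R) k : Complex x 0 ^+ k = Complex (x ^+ k) 0 :> C.
  elim: k => [//|k IH]; rewrite !exprS IH; apply/eqP; rewrite eq_complex/=.
  by apply/andP; split; apply/eqP; ring.
have := LaurentX (Num.truncn (theta^-1 ^+ n)) (Laurent_onem (LaurentX n (Laurent_chord c))).
congr Laurent; apply/funext => z; rewrite cX /step -[RHS]cX; congr (_ ^+ _).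
by apply/eqP; rewrite eq_complex/= subr0 !eqxx.
Qed.

Lemma norm_Complex_real (x : R) : `|Complex x 0 : C| = `|x|.
Proof.
apply/eqP; rewrite -(@eqrXn2 _ 2)// normC_sqr/= expr0n addr0.
by rewrite real_normK ?num_real.
Qed.

(** One factor 2 comes from [norm_cintegral_Laurent], the other from adding the bounds on |Re f| and
    |Im f|. *)
Lemma ae_bound_Fourier f K : cintegrable f ->
  (forall (n : int) k, \sum_(i < k) `|fourier_coef f (n - i%:Z)| <= K) ->
  {ae m, forall z, `|f z| <= 4 * K}.
Proof.
move=> i_f fK.
have key c theta n : `|cintegral (fun z => f z * Complex (step theta n (chord c z)) 0)| <=
    2 * K * \int[m]_z step theta n (chord c z).
  have := norm_cintegral_Laurent i_f (Laurent_step theta n c) fK.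
  rewrite mulrCA mulrA; under eq_Rintegral => z _.
    rewrite norm_Complex_real ger0_norm; last by rewrite step_ge0// chord_ge0 chord_le1.
    over.
  by [].
have bR : step_bounded (fun z => complex.Re (f z)) (2 * K).
  move=> c theta n; apply: le_trans (key c theta n); apply: le_trans (normC_ge_Re _) => /=.
  rewrite le_eqVlt; apply/orP; left; apply/eqP; congr `| _ |.
  by apply: eq_Rintegral => z _; rewrite ReM_Rcomplex/= mulr0 subr0.
have bI : step_bounded (fun z => complex.Im (f z)) (2 * K).
  move=> c theta n; apply: le_trans (key c theta n); apply: le_trans (normC_ge_Im _) => /=.
  rewrite le_eqVlt; apply/orP; left; apply/eqP; congr `| _ |.
  by apply: eq_Rintegral => z _; rewrite ImM_Rcomplex/= mulr0 add0r.
have := ae_bound bR (cintegrable_Re i_f); have := ae_bound bI (cintegrable_Im i_f).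
apply: filterS2 => z zI zR; apply: le_trans (normC_le_ReIm _) _; lra.
Qed.

(** As i varies, |n - i| takes each value at most twice, once on each side of n. *)
Lemma sum_absz_le (g : nat -> R) (S : R) : (forall i, 0 <= g i) ->
  (forall k, \sum_(i < k) g i <= S) ->
  forall (n : int) k, \sum_(i < k) g `|n - i%:Z|%N <= 2 * S.
Proof.
move=> g0 gS n k.
have S0 : 0 <= S by apply: le_trans (gS 0%N); rewrite big_ord0.
have gSm a k' : \sum_(i < k') g (a + i)%N <= S.
  apply: le_trans (gS (a + k')%N); rewrite big_split_ord/= lerDr.
  by rewrite sumr_ge0.
case: n => n; last first.
  apply: (@le_trans _ _ (\sum_(i < k) g (n.+1 + i)%N)); last by apply: le_trans (gSm _ _) _; lra.
  by apply: ler_sum => i _; rewrite NegzE -opprD -PoszD abszN.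
(* The longer sum splits just after i = n into the indices n, ..., 0 and 1, ..., k. *)
apply: (@le_trans _ _ (\sum_(i < n.+1 + k) g `|n%:Z - i%:Z|%N)).
  rewrite addnC big_split_ord/= lerDl sumr_ge0//.
rewrite big_split_ord/= mulr2n mulrDl mul1r; apply: lerD.
  apply: le_trans (gS n.+1); rewrite [leRHS](reindex_inj rev_ord_inj)/=.
  by apply: ler_sum => i _; rewrite subSS distnEl// -ltnS.
apply: le_trans (gSm 1%N k); apply: ler_sum => i _.
by rewrite addSnnS distnEr ?leq_addr// addKn add1n.
Qed.

(** Termwise x <= x^2 l + 1 / l, with x a coefficient and l its weight, replaces Cauchy-Schwarz. The
    bound is uniform over windows of integers [n - i] because these are the coefficients that a
    Laurent polynomial meets. *)
Lemma Fourier_sum_bound (lambda : nat -> {posnum R}) f :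
  (ell2norm lambda f < +oo)%E ->
  (\sum_(0 <= n <oo) ((lambda n)%:num^-1)%:E < +oo)%E ->
  exists K, forall (n : int) k, \sum_(i < k) `|fourier_coef f (n - i%:Z)| <= K.
Proof.
rewrite /ell2norm; set a := fun n : int => _ => al.
have a0 n : (0 <= a n)%E by rewrite lee_fin mulr_ge0.
have {}al : (\esum_(n in [set: int]) a n < +oo)%E.
  by move: al; case: (\esum_(n in [set: int]) a n)%E => [r| |]; rewrite ?ltry//=.
pose b n : \bar R := ((lambda n)%:num^-1)%:E.
rewrite -[X in (X < _)%E]/(\sum_(0 <= n <oo) b n)%E => bl.
have b0 n : (0 <= b n)%E by rewrite lee_fin invr_ge0.
pose A := fine (\esum_(n in [set: int]) a n); pose B := fine (\sum_(0 <= n <oo) b n).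
have aA (n : int) k : \sum_(i < k) `|fourier_coef f (n - i%:Z)| ^+ 2 *
    (lambda `|n - i%:Z|%N)%:num <= A.
  rewrite -lee_fin fineK ?ge0_fin_numE ?esum_ge0//.
  apply: esum_ge; exists ((fun i : nat => n - i%:Z) @` `I_k).
    by split => //; apply: finite_image; exact: finite_II.
  have inj : set_inj `I_k (fun i : nat => n - i%:Z).
    by move=> i j _ _ /addrI/oppr_inj[].
  rewrite -esum_fset; [|by apply: finite_image; exact: finite_II|by move=> ? _; exact: a0].
  rewrite esum_image// esum_fset; [|exact: finite_II|by move=> ? _; exact: a0].
  by rewrite -fsbig_ord sumEFin.
have bB k : \sum_(i < k) (lambda i)%:num^-1 <= B.
  rewrite -lee_fin fineK ?ge0_fin_numE ?nneseries_ge0//.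
  apply: le_trans (nneseries_lim_ge k _) => //.
  by rewrite big_mkord sumEFin.
exists (A + 2 * B) => n k.
have inv0 i : 0 <= (lambda i)%:num^-1 by rewrite invr_ge0.
apply: le_trans (lerD (aA n k) (sum_absz_le inv0 bB n k)).
rewrite -big_split/=; apply: ler_sum => i _.
set x := `|_|; set l := (lambda _)%:num.
have l0 : 0 < l by rewrite /l.
rewrite -(ler_pM2r l0) mulrDl mulVf ?gt_eqF//.
(* Expanding the square gives x l <= (x l)^2 + 1/4, which is more than enough. *)
have : 0 <= (x * l - 2^-1) ^+ 2 by exact: sqr_ge0.
nra.
Qed.

Lemma measurable_superlevel f K : cmeasurable f -> measurable [set z | K < `|f z|].
Proof.
move=> mf; have := cmeasurable_norm mf measurableT (measurable_itv `]K, +oo[).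
rewrite setTI; congr measurable.
by apply/seteqP; split=> z /=; rewrite in_itv/= andbT.
Qed.

Lemma not_everywhere_locally_unbounded (lambda : nat -> {posnum R}) (f : S2 lambda) :
  (\sum_(0 <= n <oo) ((lambda n)%:num^-1)%:E < +oo)%E ->
  ~ everywhere_locally_unbounded f.
Proof.
move=> lfin uf; have [mf lf f2] := S2funP (generic_quotient.repr f).
have [K fK] := Fourier_sum_bound lf lfin.
have [N [mN N0 fN]] := ae_bound_Fourier (cintegrable_L2 mf f2) fK.
have aT : Defs.arc (@expi R @` [set` `]0, 1[]) by exists 0, 1.
have M0 : 0 < `|4 * K| + 1 by rewrite ltr_pwDr.
have := uf _ (`|4 * K| + 1) aT M0.
apply/negP; rewrite -leNgt -N0; apply: le_measure; rewrite ?inE//.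
  by apply: measurableI; [exact: measurable_arc|exact: measurable_superlevel].
move=> z [_ /= Mz]; apply: fN => /= zK.
have := lt_le_trans Mz zK; apply/negP; rewrite -leNgt.
by apply: le_trans (ler_norm _) _; rewrite lerDl.
Qed.

End Fourier_bound.

(** * Norm estimates *)

Section L2_estimates.
Variable R : realType.
Local Notation C := (Rcomplex R).
Local Notation T := (circle R).
Local Notation m := (@circle_measure R).
Implicit Types (f g : T -> C) (b : R).

Lemma cmeasurableB f g : cmeasurable f -> cmeasurable g ->
  cmeasurable (fun z => f z - g z).
Proof.
move=> mf mg; rewrite (_ : (fun _ => _) = f \+ (fun z => -1 *: g z)).
  by apply: cmeasurableD => //; exact: cmeasurableZ.
by apply/funext => z /=; rewrite scaleN1r.
Qed.

Lemma measurable_norm2 f : cmeasurable f ->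
  measurable_fun setT (fun z => (`|f z| ^+ 2)%:E).
Proof.
by move=> mf; apply/measurable_EFinP; apply: measurable_funX; exact: cmeasurable_norm.
Qed.

Lemma L2norm_le f b : 0 <= b ->
  (L2norm f <= b%:E)%E = (\int[m]_z (`|f z| ^+ 2)%:E <= (b ^+ 2)%:E)%E.
Proof.
move=> b0; rewrite L2normE.
have : (0 <= \int[m]_z (`|f z| ^+ 2)%:E)%E.
  by apply: integral_ge0 => z _; rewrite lee_fin sqr_ge0.
case: (\int[m]_z _)%E => [r| |]//=; rewrite !lee_fin => r0.
by rewrite -[in RHS](sqr_sqrtr r0) ler_sqr ?nnegrE ?sqrtr_ge0.
Qed.

Lemma ell2norm_le lambda f b : 0 <= b ->
  (ell2norm lambda f <= b%:E)%E = (\esum_(n in [set: int])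
    (`|fourier_coef f n| ^+ 2 * (lambda `|n|%N)%:num)%:E <= (b ^+ 2)%:E)%E.
Proof.
move=> b0; rewrite /ell2norm.
have : (0 <= \esum_(n in [set: int])
    (`|fourier_coef f n| ^+ 2 * (lambda `|n|%N)%:num)%:E)%E.
  by apply: esum_ge0 => n _; rewrite lee_fin mulr_ge0.
case: (\esum_(n in _) _)%E => [r| |]//=; rewrite !lee_fin => r0.
by rewrite -[in RHS](sqr_sqrtr r0) ler_sqr ?nnegrE ?sqrtr_ge0.
Qed.

Lemma L1_le_L2 f : cmeasurable f -> (\int[m]_z `|f z|%:E <= L2norm f)%E.
Proof.
move=> mf; have m1 : measurable_fun setT (cst 1 : T -> R) by exact: measurable_cst.
have h2 : 2^-1 + 2^-1 = 1 :> R by field.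
have := hoelder m (cmeasurable_norm mf) m1 (ltr0n _ 2) (ltr0n _ 2) h2.
have -> : Lnorm m 2%:E (EFin \o cst 1) = 1%E.
  by rewrite [LHS]Lnorm_cst1 [X in (X `^ _)%E]probability_setT poweR_EFin powR1.
rewrite mule1 Lnorm1; apply: le_trans; rewrite le_eqVlt; apply/orP; left; apply/eqP.
by apply: eq_integral => z _; rewrite /= mulr1 normr_id.
Qed.

(** Gives convergence of each coefficient along L^2 limits, for which the constant is immaterial. *)
Lemma norm_fourier_coef f n : cmeasurable f -> (L2norm f < +oo)%E ->
  (`|fourier_coef f n|%:E <= 2%:E * L2norm f)%E.
Proof.
move=> mf f2; have i_f := cintegrable_L2 mf f2.
have i_fn : cintegrable (fun z => f z * sval z ^ (- n)).
  by apply: (@cintegrableM _ _ _ 1 i_f (cmeasurable_exp R _)) => z; rewrite norm_circle_exp.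
apply: (@le_trans _ _ (2 * \int[m]_z `|f z|)%:E).
  rewrite lee_fin; apply: le_trans (norm_cintegral i_fn) _.
  by under eq_Rintegral do rewrite normCM norm_circle_exp mulr1.
rewrite EFinM lee_wpmul2l ?lee_fin//.
apply: le_trans (L1_le_L2 mf).
by rewrite /Rintegral fineK// (integrable_fin_num measurableT i_f.2).
Qed.

End L2_estimates.

(** * Polynomials of small norm and large value at a point *)

Section peak.
Variable R : realType.
Local Notation C := (Rcomplex R).
Local Notation T := (circle R).
Local Notation normC w := (@Num.norm R C w).
Variable lambda : nat -> {posnum R}.

(** If these sums were bounded, their terms would tend to 0; once a term is below 1/2, lambda_n > 1
    and 1 / lambda_n <= 2 / (lambda_n + 1), so the original series would converge. *)
Lemma sum_inv_succ_unbounded (A : R) :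
  (\sum_(0 <= n <oo) ((lambda n)%:num^-1)%:E = +oo)%E ->
  exists N, A < \sum_(n < N) ((lambda n)%:num + 1)^-1.
Proof.
move=> loo; apply: contrapT => /forallNP H.
pose u n := ((lambda n)%:num + 1)^-1.
have u0 n : 0 <= u n by rewrite invr_ge0.
have uA N : \sum_(n < N) u n <= A by rewrite leNgt; apply/negP; exact: H.
have /cvg_series_cvg_0/cvgrPdist_lt/(_ 2^-1) : cvgn (series u).
  apply: nondecreasing_is_cvgn; first exact: nondecreasing_series.
  by exists A => _ [N _ <-]; rewrite /series/= big_mkord.
move=> /(_ ltac:(by []))[n0 _ small].
pose B : R := \sum_(n < n0) (lambda n)%:num^-1.
have : (\sum_(0 <= n <oo) ((lambda n)%:num^-1)%:E <= (B + 2 * A)%:E)%E.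
  apply: lime_le; first by apply: is_cvg_nneseries => n _ _; rewrite lee_fin invr_ge0.
  apply: nearW => N; rewrite big_mkord sumEFin lee_fin.
  apply: (@le_trans _ _ (\sum_(n < n0 + N) (lambda n)%:num^-1)).
    by rewrite addnC big_split_ord/= lerDl sumr_ge0// => i _; rewrite invr_ge0.
  rewrite big_split_ord/= lerD2l.
  apply: (@le_trans _ _ (2 * \sum_(n < n0 + N) u n)); last by rewrite ler_pM2l.
  rewrite big_split_ord/= mulrDr -[leLHS]add0r lerD ?mulr_ge0 ?sumr_ge0//.
  rewrite mulr_sumr; apply: ler_sum => i _.
  have := small (n0 + i)%N (leq_addr _ _); rewrite sub0r normrN ger0_norm// /u.
  set l := (lambda _)%:num; have l0 : 0 < l by rewrite /l.
  rewrite ltf_pV2 ?posrE ?addr_gt0// => l1.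
  by rewrite ler_pdivlMr ?addr_gt0// mulrC ler_pdivrMr// ; lra.
by rewrite loo leye_eq.
Qed.

Lemma peak_poly (w : T) (K e : R) : 0 < K -> 0 < e ->
  (\sum_(0 <= n <oo) ((lambda n)%:num^-1)%:E = +oo)%E ->
  exists p : {poly C}, [/\ normC p.[sval w] = K,
    (L2norm (fun z : T => p.[sval z]) <= e%:E)%E &
    (ell2norm lambda (fun z : T => p.[sval z]) <= e%:E)%E].
Proof.
move=> K0 e0 loo.
(* The sum of the squared norms will be K^2 / A, and this N makes it less than e^2. *)
have [N AN] := sum_inv_succ_unbounded (K ^+ 2 / e ^+ 2) loo.
set A := \sum_(n < N) _ in AN.
have A0 : 0 < A by apply: le_lt_trans AN; rewrite divr_ge0 ?sqr_ge0.
(* Up to scaling, the c n are the maximizers of \sum c n when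
   \sum c n ^+ 2 * (lambda n + 1) is fixed. *)
pose c n : R := K / A * ((lambda n)%:num + 1)^-1.
have c0 n : 0 <= c n by rewrite mulr_ge0 ?invr_ge0// divr_ge0// ltW.
(* The phases w^-i align all terms at w, where the value is the sum of the c i, namely K. *)
pose p : {poly C} := \poly_(i < N) (c i *: (sval w ^- i)).
have wX i : normC ((sval w : C) ^- i) = 1 by rewrite normCV normCX norm_circle expr1n invr1.
have pi i : (i < N)%N -> normC p`_i = c i.
  by move=> iN; rewrite coef_poly iN normCZ wX mulr1 ger0_norm.
have sp : (size p <= N)%N by exact: size_poly.
have cE : \sum_(i < N) c i ^+ 2 * ((lambda i)%:num + 1) <= e ^+ 2.
  rewrite (_ : \sum_(i < N) _ = K ^+ 2 / A); last first.
    rewrite (_ : K ^+ 2 / A = K ^+ 2 / A ^+ 2 * A); last by field; rewrite gt_eqF.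
    rewrite -[X in _ = _ * X]/(\sum_(n < N) ((lambda n)%:num + 1)^-1) mulr_sumr.
    apply: eq_bigr => i _; rewrite /c.
    by field; rewrite (gt_eqF A0) gt_eqF// addr_gt0.
  rewrite ler_pdivrMr// mulrC -ler_pdivrMr ?exprn_gt0//; exact: ltW.
have le_e x : x <= \sum_(i < N) c i ^+ 2 * ((lambda i)%:num + 1) -> Num.sqrt x <= e.
  move=> xe; rewrite -[leRHS](gtr0_norm e0) -sqrtr_sqr.
  exact: ler_wsqrtr (le_trans xe cE).
exists p; split.
- rewrite horner_poly (_ : \sum_(i < N) _ = K *: 1).
    by rewrite normCZ normC1 mulr1 gtr0_norm.
  transitivity ((\sum_(i < N) c i) *: (1 : C)).
    rewrite scaler_suml; apply: eq_bigr => i _.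
    by rewrite scaleCAl mulVf// expf_neq0// circle_neq0.
  by congr (_ *: _); rewrite /c -mulr_sumr -/A divfK// gt_eqF.
- rewrite (L2norm_horner sp) lee_fin; apply: le_e; apply: ler_sum => i _.
  by rewrite pi// ler_peMr ?sqr_ge0// lerDr.
- rewrite (ell2norm_horner lambda sp) lee_fin; apply: le_e; apply: ler_sum => i _.
  by rewrite pi// ler_wpM2l ?sqr_ge0// lerDl.
Qed.

End peak.

(** * Representatives, measure of arcs and local variation of polynomials *)

Section S2_representatives.
Variables (R : realType) (lambda : nat -> {posnum R}).
Local Notation C := (Rcomplex R).
Local Notation T := (circle R).
Local Notation m := (@circle_measure R).
Local Open Scope quotient_scope.
Implicit Types (f g : S2fun lambda) (F G : S2 lambda).

Lemma S2_cmeasurable F : cmeasurable F.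
Proof. by have [] := S2funP (repr F). Qed.

Lemma S2_L2norm_fin F : L2norm F \is a fin_num.
Proof. by have [_ _ F2] := S2funP (repr F); rewrite ge0_fin_numE ?L2norm_ge0. Qed.

Lemma S2_ell2norm_fin F : ell2norm lambda F \is a fin_num.
Proof. by have [_ Fl _] := S2funP (repr F); rewrite ge0_fin_numE ?ell2norm_ge0. Qed.

Lemma S2_norm_ge_L2 F : (L2norm F <= `|F|%:E)%E.
Proof.
rewrite S2_normE EFinD !fineK ?S2_L2norm_fin ?S2_ell2norm_fin//.
by rewrite leeDr// ell2norm_ge0.
Qed.

Lemma S2_norm_ge_ell2 F : (ell2norm lambda F <= `|F|%:E)%E.
Proof.
rewrite S2_normE EFinD !fineK ?S2_L2norm_fin ?S2_ell2norm_fin//.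
by rewrite leeDl// L2norm_ge0.
Qed.

Lemma S2_norm_pi f : `|\pi_(S2 lambda) f : S2 lambda| =
  fine (ell2norm lambda f) + fine (L2norm f).
Proof.
have [mf _ _] := S2funP f; have H := S2_piE f.
by rewrite S2_normE (ell2norm_ae _ (S2_cmeasurable _) mf H) (L2norm_ae (S2_cmeasurable _) mf H).
Qed.

Lemma S2_fun_sub F G : {ae m, forall z, (F - G : S2 lambda) z = F z - G z}.
Proof.
elim/quotW: F => f; elim/quotW: G => g.
have -> : \pi_(S2 lambda) f - \pi_(S2 lambda) g = \pi_(S2 lambda) (f - g) :> S2 lambda.
  by rewrite !piE.
have Hf := S2_piE f; have Hg := S2_piE g; have Hfg := S2_piE (f - g).
move: Hf Hg Hfg; apply: filterS3 => z -> -> ->.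
exact: S2funB.
Qed.

(** Chebyshev's inequality at level 1. *)
Lemma measure_le_L2norm (J : set T) (f : T -> C) (e : R) : 0 <= e ->
  measurable J -> cmeasurable f -> {ae m, forall z, J z -> 1 <= `|f z|} ->
  (L2norm f <= e%:E)%E -> (m J <= (e ^+ 2)%:E)%E.
Proof.
move=> e0 mJ mf f1; rewrite L2norm_le//; apply: le_trans.
rewrite -[m J]mul1e -integral_cst//=.
apply: (@le_trans _ _ (\int[m]_(z in J) (`|f z| ^+ 2)%:E)%E).
  apply: ae_ge0_le_integral => //.
  - exact: measurable_funTS (measurable_norm2 mf).
  - by apply: filterS f1 => z f1 /f1 fz; rewrite lee_fin -[leLHS](expr1n _ 2) ler_sqr ?nnegrE.
by apply: ge0_subset_integral => //; exact: measurable_norm2.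
Qed.

Lemma expiDz (t : R) (k : int) : expi (t + k%:~R) = expi t.
Proof.
have k1 : expi (k%:~R : R) = expi 0.
  apply: val_inj => /=; have := expiX (1 : R) k; rewrite expi1 exp1rz mulr1 => <-.
  by rewrite mulr0 cos0 sin0.
by have := expi_shift t k1; rewrite add0r addrC.
Qed.

Lemma measure_arc_gt0 (J : set T) : Defs.arc J -> (0 < m J)%E.
Proof.
move=> [a [b [ab ->]]].
(* The measure is computed on [0, 1[, so the midpoint is moved there by an integer. Only the
   interval to its right is kept, since s may be 0; d keeps it both in the arc and below 1. *)
pose c := (a + b) / 2; pose s := c - (Num.floor c)%:~R.
have s0 : 0 <= s by rewrite subr_ge0 floor_le_tmp.
have s1 : s < 1 by rewrite ltrBlDl; have := floorD1_gt c; rewrite intrD.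
pose d := Num.min ((b - a) / 2) (1 - s).
have d0 : 0 < d by rewrite lt_min subr_gt0 s1 divr_gt0 ?subr_gt0.
have dba : d <= (b - a) / 2 by rewrite ge_min lexx.
have d1s : d <= 1 - s by rewrite ge_min lexx orbT.
apply: (@lt_le_trans _ _ (lebesgue_measure (`]s, s + d[%classic : set R))).
  by rewrite lebesgue_measure_itv/= lte_fin ltrDl d0 -EFinB addrAC subrr add0r lte_fin.
have ma : measurable ((@expi R) @` [set` `]a, b[]) by apply: measurable_arc; exists a, b.
apply: le_measure; rewrite ?inE; [exact: measurable_itv| |].
  by apply: measurableI => //; exact: ma.
move=> t /=; rewrite !in_itv/= => /andP[st tsd]; split; last by apply/andP; split; lra.
rewrite /s /c in st tsd dba *.
exists (t + (Num.floor c)%:~R); first by rewrite in_itv/= -/c; apply/andP; split; lra.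
by rewrite expiDz.
Qed.

Lemma continuous_horner_expi (p : {poly C}) :
  continuous (fun t => complex.Re p.[sval (expi t)]) /\
  continuous (fun t => complex.Im p.[sval (expi t)]).
Proof.
have cc (F : R -> R) : continuous F -> continuous (fun t : R => F (2 * pi * t)).
  move=> cF t; apply: cvg_comp; last exact: cF.
  by apply: cvgM; [exact: cvg_cst|exact: cvg_id].
have cr := cc _ (@continuous_cos R); have ci := cc _ (@continuous_sin R).
elim/poly_ind: p => [|p c [IHr IHi]].
  by split => t; under eq_fun do rewrite horner0; exact: cvg_cst.
split => t.
- rewrite (_ : (fun _ => _) = fun t => complex.Re p.[sval (expi t)] * cos (2 * pi * t) -
    complex.Im p.[sval (expi t)] * sin (2 * pi * t) + complex.Re c).
    apply: cvgD; last exact: cvg_cst.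
    by apply: cvgB; apply: cvgM; [exact: IHr|exact: cr|exact: IHi|exact: ci].
  by apply/funext => x; rewrite hornerMXaddC raddfD/= ReM_Rcomplex.
- rewrite (_ : (fun _ => _) = fun t => complex.Re p.[sval (expi t)] * sin (2 * pi * t) +
    complex.Im p.[sval (expi t)] * cos (2 * pi * t) + complex.Im c).
    apply: cvgD; last exact: cvg_cst.
    by apply: cvgD; apply: cvgM; [exact: IHr|exact: ci|exact: IHi|exact: cr].
  by apply/funext => x; rewrite hornerMXaddC raddfD/= ImM_Rcomplex.
Qed.

Lemma near_horner_expi (p : {poly C}) (c e : R) : 0 < e ->
  exists2 d, 0 < d & forall t, `|c - t| < d ->
  @Num.norm R C (p.[sval (expi c)] - p.[sval (expi t)]) < e.
Proof.
move=> e0; have e2 : 0 < e / 2 by rewrite divr_gt0.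
have [/(_ c)/cvgrPdist_lt/(_ _ e2) r /(_ c)/cvgrPdist_lt/(_ _ e2) i] := continuous_horner_expi p.
have [d /= d0 H] := (nbhs_ballP _ _).1 (filterI r i); exists d => // t ct.
have [/= {}r {}i] := H t ct.
apply: le_lt_trans (normC_le_ReIm _) _; rewrite !raddfB/= (splitr e).
exact: ltrD.
Qed.

End S2_representatives.

(** * Completeness *)

Section L2_completeness.
Variable R : realType.
Local Notation C := (Rcomplex R).
Local Notation T := (circle R).
Local Notation m := (@circle_measure R).
Local Notation normC w := (@Num.norm R C w).
Implicit Types (f : T -> C) (u : nat -> T -> C).

Definition ae_cvg u f := {ae m, forall z,
  complex.Re (u n z) @[n --> \oo] --> complex.Re (f z) /\
  complex.Im (u n z) @[n --> \oo] --> complex.Im (f z)}.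

Lemma cvg_of_summable_steps (x : nat -> R) (a : nat -> R) :
  (forall n, `|x n.+1 - x n| <= a n) -> cvgn (series a) -> cvgn x.
Proof.
move=> xa ca; have : cvgn (series (telescope x)).
  apply: normed_cvg; apply: (series_le_cvg _ _ xa ca) => n //=.
  exact: le_trans (xa n).
move=> cs; apply/cvg_ex; exists (x 0%N + limn (series (telescope x))).
rewrite [X in X @ _ --> _](_ : x = fun n => x 0%N + series (telescope x) n).
  by apply: cvgD; [exact: cvg_cst|exact: cs].
by apply/funext => n; exact: eq_sum_telescope.
Qed.

(** Riesz-Fischer: the steps have L^1 norms at most 2^-n, so the sum of their moduli is integrable,
    hence finite almost everywhere, and the telescoping series converges there. *)
Lemma fast_L2_ae_cvg u : (forall n, cmeasurable (u n)) ->
  (forall n, (L2norm (fun z => u n.+1 z - u n z)%R <= (2^-1 ^+ n)%:E)%E) ->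
  exists2 f, cmeasurable f & ae_cvg u f.
Proof.
move=> mu_ hu.
have md n : cmeasurable (fun z => u n.+1 z - u n z) by exact: cmeasurableB.
pose d n (z : T) := (normC (u n.+1 z - u n z))%:E.
have md' n : measurable_fun setT (d n).
  by apply/measurable_EFinP; exact: cmeasurable_norm.
have d0 n z : (0 <= d n z)%E by rewrite lee_fin.
have iS : m.-integrable setT (fun z => \sum_(0 <= n <oo) d n z)%E.
  apply/integrableP; split; first exact: ge0_emeasurable_sum.
  under eq_integral do rewrite gee0_abs ?nneseries_ge0//.
  rewrite integral_nneseries//.
  apply: (@le_lt_trans _ _ (\sum_(0 <= n <oo) (2^-1 ^+ n)%:E)%E).
    apply: lee_nneseries => [n _ _|n _]; first exact: integral_ge0.
    exact: le_trans (L1_le_L2 (md n)) (hu n).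
  apply: (@le_lt_trans _ _ (1 * (1 - 2^-1)^-1)%:E); last exact: ltry.
  apply: lime_le; first by apply: is_cvg_nneseries => n _ _; rewrite lee_fin exprn_ge0.
  apply: nearW => N; rewrite sumEFin lee_fin.
  have h1 : `|2^-1 : R| < 1 by rewrite ger0_norm// invf_lt1// ltr1n.
  have h0 : 0 < 2^-1 :> R by [].
  apply: le_trans (geometric_le_lim N ler01 h0 h1).
  by rewrite /series/=; apply: ler_sum => i _; rewrite mul1r.
have cv : {ae m, forall z, cvgn (fun n => complex.Re (u n z)) /\
    cvgn (fun n => complex.Im (u n z))}.
  move: (integrable_ae measurableT iS); apply: filterS => z /(_ I) fz.
  have cS : cvgn (series (fun n => normC (u n.+1 z - u n z))).
    apply: nondecreasing_is_cvgn; first exact: nondecreasing_series.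
    exists (fine (\sum_(0 <= n <oo) d n z)%E) => _ [N _ <-].
    rewrite -lee_fin fineK// /series/= -sumEFin; exact: nneseries_lim_ge.
  split; apply: cvg_of_summable_steps cS => n.
  - by apply: le_trans (normC_ge_Re _); rewrite raddfB.
  - by apply: le_trans (normC_ge_Im _); rewrite raddfB.
(* Off the null set where F (u n z) diverges, the upper limit is the limit; it
   is used because it is measurable on the whole circle. *)
pose g (F : C -> R) (z : T) := fine (limn_esup (fun n => (F (u n z))%:E)).
have mg F : (forall n, measurable_fun setT (fun z => F (u n z))) -> measurable_fun setT (g F).
  move=> mF; apply: measurableT_comp => //.
  by apply: measurable_fun_limn_esup => n; exact/measurable_EFinP.
have gE F z : cvgn (fun n => F (u n z)) -> F (u n z) @[n --> \oo] --> g F z.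
  move=> cF; have cE : (F (u n z))%:E @[n --> \oo] --> (limn (fun n => F (u n z)))%:E.
    by apply: cvg_EFin => //; exact: nearW.
  by rewrite /g (cvg_limn_einf_sup cE).2.
exists (fun z => Complex (g (@complex.Re R) z) (g (@complex.Im R) z)).
  by split; apply: mg => n; have [? ?] := mu_ n.
by apply: filterS cv => z [cr ci]; split; exact: gE.
Qed.

Lemma L2norm_fatou u f b : 0 <= b -> (forall n, cmeasurable (u n)) -> cmeasurable f ->
  ae_cvg u f -> (forall n, (L2norm (u n) <= b%:E)%E) -> (L2norm f <= b%:E)%E.
Proof.
move=> b0 mu_ mf uf ub; rewrite L2norm_le//.
have pos n z : setT z -> (0 <= (`|u n z| ^+ 2)%:E)%E by move=> _; rewrite lee_fin sqr_ge0.
have le := fatou m measurableT (fun n => measurable_norm2 (mu_ n)) pos.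
have -> : (\int[m]_z (`|f z| ^+ 2)%:E =
    \int[m]_z limn_einf (fun n => (`|u n z| ^+ 2)%:E))%E.
  apply: ae_eq_integral => //; first exact: measurable_norm2.
    apply: measurableT_comp (@oppe_measurable R setT) _.
    apply: measurable_fun_limn_esup => n.
    by apply: measurableT_comp (@oppe_measurable R setT) _; exact: measurable_norm2.
  apply: filterS uf => z [cr ci] _.
  have cn : (`|u n z| ^+ 2)%:E @[n --> \oo] --> (`|f z| ^+ 2)%:E.
    apply: cvg_EFin; first exact: nearW.
    under eq_fun do rewrite /comp/= normC_sqr; rewrite normC_sqr.
    by apply: cvgD; apply: cvgM.
  by rewrite (cvg_limn_einf_sup cn).1.
apply: le_trans le _; rewrite limn_einf_lim; apply: lime_le; first exact: is_cvg_einfs.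
apply: nearW => n; apply: (@le_trans _ _ (\int[m]_z (`|u n z| ^+ 2)%:E)%E).
  by apply: ereal_inf_lbound; exists n => /=.
by rewrite -L2norm_le.
Qed.

End L2_completeness.

Section S2_complete.
Variables (R : realType) (lambda : nat -> {posnum R}).
Local Notation C := (Rcomplex R).
Local Notation T := (circle R).
Local Notation m := (@circle_measure R).
Local Notation normC w := (@Num.norm R C w).
Local Open Scope quotient_scope.
Implicit Types (f : T -> C) (u : nat -> T -> C) (F G : S2 lambda).

Lemma fourier_coefB (f g : T -> C) n : cmeasurable f -> (L2norm f < +oo)%E ->
  cmeasurable g -> (L2norm g < +oo)%E ->
  fourier_coef (fun z => f z - g z) n = fourier_coef f n - fourier_coef g n.
Proof.
move=> mf f2 mg g2; rewrite (_ : (fun _ => _) = f \+ (fun z => -1 *: g z)).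
  rewrite fourier_coefD ?fourier_coefZ ?scaleN1r//; first exact: cmeasurableZ.
  by rewrite L2normZ// lte_mul_pinfty.
by apply/funext => z /=; rewrite scaleN1r.
Qed.

(** The norm is a supremum over finite sets of frequencies, and each finite sum passes to the
    limit. *)
Lemma ell2norm_fatou u f (b : R) : 0 <= b ->
  (forall n, (fun k => normC (fourier_coef (u k) n - fourier_coef f n)) @ \oo --> (0 : R)) ->
  (forall k, (ell2norm lambda (u k) <= b%:E)%E) -> (ell2norm lambda f <= b%:E)%E.
Proof.
move=> b0 uf ub; rewrite ell2norm_le//.
apply: ge_ereal_sup => _ [X [finX _] <-].
rewrite fsbig_finite//= sumEFin lee_fin.
have cn n : normC (fourier_coef (u k) n) @[k --> \oo] --> normC (fourier_coef f n).
  apply/cvgrPdist_le => e e0.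
  have /cvgrPdist_le/(_ e e0) := uf n; apply: filterS => k.
  rewrite sub0r normrN normr_id; apply: le_trans.
  by rewrite distrC; exact: ler_dist_dist.
have cs (s : seq int) :
    (fun k => \sum_(n <- s) normC (fourier_coef (u k) n) ^+ 2 * (lambda `|n|%N)%:num)
    @ \oo --> \sum_(n <- s) normC (fourier_coef f n) ^+ 2 * (lambda `|n|%N)%:num.
  elim: s => [|n s IH]; first by rewrite big_nil; under eq_fun do rewrite big_nil; exact: cvg_cst.
  rewrite big_cons; under eq_fun do rewrite big_cons.
  apply: cvgD IH; apply: cvgM; last exact: cvg_cst.
  by apply: cvgM; exact: cn.
apply: cvgr_to_le (cs _) _; apply: nearW => k.
rewrite -lee_fin -sumEFin -fsbig_finite//.
have := ub k; rewrite ell2norm_le//; apply: le_trans.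
by apply: ereal_sup_ubound; exists X.
Qed.

Lemma S2_dist F G : `|F - G| = fine (ell2norm lambda (fun z => F z - G z)) +
  fine (L2norm (fun z => F z - G z)).
Proof.
have mFG := cmeasurableB (S2_cmeasurable F) (S2_cmeasurable G).
rewrite S2_normE (ell2norm_ae _ (S2_cmeasurable _) mFG (S2_fun_sub F G)).
by rewrite (L2norm_ae (S2_cmeasurable _) mFG (S2_fun_sub F G)).
Qed.

Lemma S2_dist_L2 F G : (L2norm (fun z => F z - G z)%R <= `|F - G|%:E)%E.
Proof.
have mFG := cmeasurableB (S2_cmeasurable F) (S2_cmeasurable G).
by rewrite -(L2norm_ae (S2_cmeasurable _) mFG (S2_fun_sub F G)) S2_norm_ge_L2.
Qed.

Lemma S2_dist_ell2 F G : (ell2norm lambda (fun z => F z - G z)%R <= `|F - G|%:E)%E.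
Proof.
have mFG := cmeasurableB (S2_cmeasurable F) (S2_cmeasurable G).
by rewrite -(ell2norm_ae _ (S2_cmeasurable _) mFG (S2_fun_sub F G)) S2_norm_ge_ell2.
Qed.

Lemma S2_fast_cvg (F : nat -> S2 lambda) :
  (forall n, `|F n.+1 - F n| <= 2^-1 ^+ n) -> cvgn F.
Proof.
move=> hF.
have hFk n k : `|F (n + k)%N - F n| <= 2 * 2^-1 ^+ n.
  (* The exact geometric sum is what makes the induction on k close. *)
  suff : `|F (n + k)%N - F n| <= 2 * 2^-1 ^+ n - 2 * 2^-1 ^+ (n + k).
    by move/le_trans; apply; rewrite gerBl mulr_ge0// exprn_ge0.
  elim: k => [|k IH]; first by rewrite addn0 !subrr normr0.
  rewrite addnS -(subrKA (F (n + k)%N)) [X in `|X|]addrC.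
  apply: le_trans (ler_normD _ _) _; apply: le_trans (lerD IH (hF _)) _.
  by rewrite [in leRHS]exprS mulrA mulfV// mul1r; lra.
have mF n := S2_cmeasurable (F n).
have F2 n : (L2norm (F n) < +oo)%E by rewrite -ge0_fin_numE ?L2norm_ge0 ?S2_L2norm_fin.
have [|f mf Ff] := @fast_L2_ae_cvg R F mF.
  by move=> n; apply: le_trans (S2_dist_L2 _ _) _; rewrite lee_fin.
have b0 n : 0 <= 2 * 2^-1 ^+ n :> R by rewrite mulr_ge0// exprn_ge0.
have mfF n := cmeasurableB mf (mF n).
(* Lower semicontinuity, as k grows, applied to F (n + k) - F n gives the rate of convergence; the
   case n = 0 also puts f in the space. *)
have f2 n : (L2norm (fun z => f z - F n z)%R <= (2 * 2^-1 ^+ n)%:E)%E.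
  apply: (@L2norm_fatou R (fun k z => F (n + k)%N z - F n z)) => //.
  - by move=> k; exact: cmeasurableB.
  - have sh (x : nat -> R) l : x k @[k --> \oo] --> l -> x (n + k)%N @[k --> \oo] --> l.
      by rewrite -(cvg_shiftn n x) => xl; under eq_fun do rewrite addnC; exact: xl.
    apply: filterS Ff => z [/sh cr /sh ci]; split.
      rewrite raddfB/=; under eq_fun do rewrite raddfB/=.
      by apply: cvgB; [exact: cr|exact: cvg_cst].
    rewrite raddfB/=; under eq_fun do rewrite raddfB/=.
    by apply: cvgB; [exact: ci|exact: cvg_cst].
  - by move=> k; apply: le_trans (S2_dist_L2 _ _) _; rewrite lee_fin.
have f2n n : (L2norm (fun z => f z - F n z)%R < +oo)%E.
  by apply: le_lt_trans (f2 n) _; exact: ltry.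
have fE : f = (fun z => f z - F 0%N z) \+ F 0%N by apply/funext => z /=; rewrite subrK.
have f2oo : (L2norm f < +oo)%E.
  rewrite fE; apply: le_lt_trans (L2normD (mfF 0%N) (mF 0%N)) _.
  by rewrite lte_add_pinfty.
have fl n : (ell2norm lambda (fun z => f z - F n z)%R <= (2 * 2^-1 ^+ n)%:E)%E.
  apply: (@ell2norm_fatou (fun k z => F (n + k)%N z - F n z)) => //; last first.
    by move=> k; apply: le_trans (S2_dist_ell2 _ _) _; rewrite lee_fin.
  (* Here 4 is the factor 2 of [norm_fourier_coef] times the 2 of [f2]. *)
  have geo : 4 * 2^-1 ^+ k @[k --> \oo] --> (0 : R).
    rewrite -(mulr0 4); apply: cvgM; first exact: cvg_cst.
    by apply: cvg_expr; rewrite ger0_norm// invf_lt1// ltr1n.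
  move=> j; apply: (@squeeze_cvgr _ _ _ _ (cst 0) (fun k => 4 * 2^-1 ^+ k)) geo; [|exact: cvg_cst].
  apply: nearW => k; rewrite normr_ge0/= !fourier_coefB// opprB addrA subrK.
  rewrite -normrN opprB -fourier_coefB// -lee_fin.
  apply: le_trans (norm_fourier_coef j (mfF (n + k)%N) (f2n (n + k)%N)) _.
  apply: le_trans (lee_wpmul2l _ (f2 (n + k)%N)) _; first by rewrite lee_fin.
  rewrite -EFinM lee_fin mulrA -natrM ler_wpM2l// exprD ler_piMl ?exprn_ge0//.
  by rewrite exprn_ile1// invf_le1// ler1n.
have pf : f \in @in_S2 R lambda.
  rewrite inE; split => //; rewrite fE.
  apply: le_lt_trans (ell2normD lambda (mfF 0%N) (f2n 0%N) (mF 0%N) (F2 0%N)) _.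
  rewrite lte_add_pinfty//; first by apply: le_lt_trans (fl 0%N) _; exact: ltry.
  by rewrite -ge0_fin_numE ?ell2norm_ge0// S2_ell2norm_fin.
have [G Gf] : exists G : S2 lambda, {ae m, forall z, G z = f z}.
  by exists (\pi_(S2 lambda) (S2Fun pf)); exact: S2_piE.
apply/cvg_ex; exists G; apply/cvgrPdist_le => e e0.
have GF n : `|G - F n| <= 4 * 2^-1 ^+ n.
  have mGF := cmeasurableB (S2_cmeasurable G) (mF n).
  have GfF : {ae m, forall z, G z - F n z = f z - F n z} by apply: filterS Gf => z ->.
  rewrite S2_dist (ell2norm_ae _ mGF (mfF n) GfF) (L2norm_ae mGF (mfF n) GfF).
  rewrite (_ : 4 * _ = 2 * 2^-1 ^+ n + 2 * 2^-1 ^+ n); last by rewrite -mulrDl -natrD.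
  apply: lerD; rewrite -lee_fin fineK//.
  - by rewrite ge0_fin_numE ?ell2norm_ge0//; apply: le_lt_trans (fl n) _; exact: ltry.
  - by rewrite ge0_fin_numE ?L2norm_ge0.
have geo : 4 * 2^-1 ^+ k @[k --> \oo] --> (0 : R).
  rewrite -(mulr0 4); apply: cvgM; first exact: cvg_cst.
  by apply: cvg_expr; rewrite ger0_norm// invf_lt1// ltr1n.
move/cvgrPdist_le/(_ e e0): geo; apply: filterS => n.
rewrite sub0r normrN ger0_norm; last by rewrite mulr_ge0// exprn_ge0.
exact: le_trans.
Qed.

Lemma S2_cauchy_cvg (H : set_system (S2 lambda)) : ProperFilter H -> cauchy H -> cvg H.
Proof.
move=> PH /cauchyP cH.
(* Balls of consecutive indices both belong to the filter, hence meet, and their centres are less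
   than 2^-(n+2) + 2^-(n+3) <= 2^-n apart. *)
have e0 n : 0 < 2^-1 ^+ n.+2 :> R by rewrite exprn_gt0.
have [F hF] := choice (fun n => cH _ (e0 n)).
have sF n : `|F n.+1 - F n| <= 2^-1 ^+ n.
  have [G []] := filter_ex (filterI (hF n) (hF n.+1)).
  rewrite -!ball_normE/= => h1 h2.
  rewrite -(subrKA G); apply: le_trans (ler_normD _ _) _.
  rewrite [X in _ + X]distrC; apply: le_trans (lerD (ltW h2) (ltW h1)) _.
  rewrite !exprS; have : 0 <= 2^-1 ^+ n :> R by rewrite exprn_ge0.
  lra.
have /cvg_ex[G FG] := S2_fast_cvg sF.
apply/cvg_ex; exists G; apply/cvg_ballP => e e1.
have /cvgrPdist_lt/(_ (e / 2)) := FG; rewrite divr_gt0// => /(_ isT) near1.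
have geo : 2^-1 ^+ n.+2 @[n --> \oo] --> (0 : R).
  have g1 : `|2^-1 : R| < 1 by rewrite ger0_norm// invf_lt1// ltr1n.
  rewrite -(mulr0 (2^-1 ^+ 2)) (_ : (fun _ => _) = fun n => 2^-1 ^+ 2 * 2^-1 ^+ n); last first.
    by apply/funext => n; rewrite -exprD.
  by apply: cvgM; [exact: cvg_cst|exact: cvg_expr].
move/cvgrPdist_lt/(_ (e / 2)) : geo; rewrite divr_gt0// => /(_ isT) near2.
have [n [/= GFn en]] := filter_ex (filterI near1 near2).
apply: filterS (hF n) => x; rewrite -!ball_normE/= => Fx.
rewrite -(subrKA (F n)); apply: le_lt_trans (ler_normD _ _) _; rewrite (splitr e).
apply: ltrD => //; apply: lt_trans Fx _.
by move: en; rewrite sub0r normrN ger0_norm// ltW.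
Qed.

HB.instance Definition _ := Uniform_isComplete.Build (S2 lambda) S2_cauchy_cvg.

Lemma S2_not_meager : ~ meager [set: S2 lambda].
Proof.
move=> [A nA AT].
have oO n : open (~` closure (A n)) /\ dense (~` closure (A n)).
  split; first by rewrite openC; exact: closed_closure.
  move=> O [F OF] oO; apply: contrapT => nO.
  have : interior (closure (A n)) F.
    apply: filterS (open_nbhs_nbhs (conj oO OF)) => G OG.
    by apply: contrapT => AG; apply: nO; exists G.
  by rewrite nA.
have [F [_ /= FA]] := Baire oO (ex_intro setT point I) openT.
have : setT F by []; rewrite AT => -[n _ AF].
by apply: (FA n I); exact: subset_closure.
Qed.

End S2_complete.

(** * Genericity *)

Section genericity.
Variables (R : realType) (lambda : nat -> {posnum R}).
Local Notation C := (Rcomplex R).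
Local Notation T := (circle R).
Local Notation m := (@circle_measure R).
Local Notation normC w := (@Num.norm R C w).
Local Open Scope quotient_scope.
Implicit Types (F G : S2 lambda) (I J : set T).

(** The bound is essential, so it does not depend on the representative of F. *)
Definition bounded_on I (M : R) : set (S2 lambda) :=
  [set F | m (I `&` [set z | M < `|F z|]) = 0%E].

Lemma bounded_on_ae I M F : measurable I -> bounded_on I M F ->
  {ae m, forall z, I z -> `|F z| <= M}.
Proof.
move=> mI IF; exists (I `&` [set z | M < `|F z|]); split => //.
  by apply: measurableI => //; apply: measurable_superlevel; exact: S2_cmeasurable.
by move=> z /= /not_implyP[Iz /negP]; rewrite -ltNge.
Qed.

(** Let the closure contain a ball around F0, and let G be a peak small enough that F0 - G is in the
    ball. Members F1 and F2 approximating F0 and F0 - G have a difference close to G in norm, yet of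
    modulus at most 2 |M| on [I], where G is larger on a whole subarc. *)
Lemma nowhere_dense_bounded_on I M : Defs.arc I ->
  (\sum_(0 <= n <oo) ((lambda n)%:num^-1)%:E = +oo)%E ->
  nowhere_dense (bounded_on I M).
Proof.
move=> aI loo; have mI := measurable_arc aI; have [a [b [ab IE]]] := aI.
rewrite /nowhere_dense -subset0 => F0 /nbhs_ballP[r /= r0 Fr].
(* 2 |M| bounds the difference of two members and 1 is lost to the variation of p on [J]; the
   remaining 2 ensures |H| >= 1 there. *)
pose c := (a + b) / 2; pose K : R := 2 * `|M| + 3.
have K0 : 0 < K by rewrite ltr_wpDl// mulr_ge0.
have r4 : 0 < r / 4 by rewrite divr_gt0.
have [p [pK p2 pl]] := peak_poly (expi c) K0 r4 loo.
have [d d0 pd] := @near_horner_expi R p c 1 ltr01.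
pose d' := Num.min d ((b - a) / 2).
have d'0 : 0 < d' by rewrite lt_min d0 divr_gt0// subr_gt0.
have d'd : d' <= d by rewrite ge_min lexx.
have d'b : d' <= (b - a) / 2 by rewrite ge_min lexx orbT.
pose J := (@expi R) @` [set` `]c - d', c + d'[].
have aJ : Defs.arc J by exists (c - d'), (c + d'); split => //; lra.
have mJ := measurable_arc aJ.
have JI : J `<=` I.
  move=> _ [t + <-]; rewrite /= in_itv/= IE => /andP[t1 t2]; exists t => //.
  rewrite /c in t1 t2.
  by rewrite /= in_itv/=; apply/andP; split; lra.
have Jp z : J z -> 2 * `|M| + 2 <= normC p.[sval z].
  move=> [t + <-]; rewrite /= in_itv/= => /andP[t1 t2].
  have /pd pt : `|c - t| < d by rewrite ltr_norml; apply/andP; split; lra.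
  have := le_lt_trans (lerB_dist (p.[sval (expi c)] : C) p.[sval (expi t)]) pt.
  by rewrite pK /K; lra.
have pS2 : (fun z : T => p.[sval z]) \in @in_S2 R lambda.
  rewrite inE; split; first exact: cmeasurable_horner.
  - by apply: le_lt_trans pl _; exact: ltry.
  - by apply: le_lt_trans p2 _; exact: ltry.
pose G : S2 lambda := \pi_(S2 lambda) (S2Fun pS2).
have Gr : `|G| < r.
  rewrite S2_norm_pi/= (splitr r).
  have h2 : fine (L2norm (fun z : T => p.[sval z])) <= r / 4.
    by rewrite -lee_fin fineK// ge0_fin_numE ?L2norm_ge0// (le_lt_trans p2)// ltry.
  have hl : fine (ell2norm lambda (fun z : T => p.[sval z])) <= r / 4.
    by rewrite -lee_fin fineK// ge0_fin_numE ?ell2norm_ge0// (le_lt_trans pl)// ltry.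
  by apply: (le_lt_trans (lerD hl h2)); lra.
have mJ0 := measure_arc_gt0 aJ.
have mJf : m J \is a fin_num by exact: fin_num_measure.
(* As e <= 1, (2 e)^2 <= 4 e < m J, which contradicts Chebyshev's bound for H. The subarc [J] is
   fixed before e. *)
pose e := Num.min 1 (fine (m J) / 5).
have fJ0 : 0 < fine (m J) by rewrite fine_gt0// mJ0 ltey_eq mJf.
have e0 : 0 < e by rewrite lt_min ltr01 divr_gt0.
have eJ : (2 * e) ^+ 2 < fine (m J).
  have e1 : e <= 1 by rewrite ge_min lexx.
  have e5 : e <= fine (m J) / 5 by rewrite ge_min lexx orbT.
  have e2 : e * e <= e * 1 by rewrite ler_wpM2l// ltW.
  by rewrite exprMn expr2 [e ^+ 2]expr2; lra.
have close F : `|F0 - F| < r -> exists2 F', bounded_on I M F' & `|F - F'| < e.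
  move=> F0F; have cF : closure (bounded_on I M) F by apply: Fr; rewrite -ball_normE.
  have [F' [bF']] := cF _ (nbhsx_ballx F e e0).
  by rewrite -ball_normE/= => FF'; exists F'.
have [F1 bF1 F01] := close F0 (ltac:(by rewrite subrr normr0)).
have [F2 bF2 F02] := close (F0 - G) (ltac:(by rewrite opprB addrC subrK)).
pose H : S2 lambda := (F1 - F2) - G.
have He : `|H| < 2 * e.
  have -> : H = ((F0 - G) - F2) - (F0 - F1).
    by rewrite /H opprB [RHS]addrC -!addrA addKr [- F2 - G]addrC.
  by rewrite mulr2n mulrDl mul1r; apply: le_lt_trans (ler_normB _ _) _; exact: ltrD.
have HJ : {ae m, forall z, J z -> 1 <= `|H z|}.
  have b1 := bounded_on_ae mI bF1; have b2 := bounded_on_ae mI bF2.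
  have Gp : {ae m, forall z, G z = p.[sval z]} := S2_piE _.
  have Hz : {ae m, forall z, H z = F1 z - F2 z - p.[sval z]}.
    move: Gp (S2_fun_sub F1 F2) (S2_fun_sub (F1 - F2) G).
    by apply: filterS3 => z <- <- <-.
  move: b1 b2 Hz; apply: filterS3 => z h1 h2 -> Jz.
  have {}h1 := h1 (JI _ Jz); have {}h2 := h2 (JI _ Jz); have pz := Jp _ Jz.
  have MM := ler_norm M.
  have := lerB_dist (p.[sval z] : C) (F1 z - F2 z); have := ler_normB (F1 z) (F2 z).
  rewrite -[normC (p.[sval z] - _)]normrN opprB; lra.
have L2H : (L2norm H <= (2 * e)%:E)%E.
  by apply: le_trans (S2_norm_ge_L2 H) _; rewrite lee_fin ltW.
have e20 : 0 <= 2 * e by rewrite mulr_ge0// ltW.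
have := measure_le_L2norm e20 mJ (S2_cmeasurable H) HJ L2H.
by rewrite -(fineK mJf) lee_fin leNgt eJ.
Qed.

Lemma generic_everywhere_locally_unbounded :
  (\sum_(0 <= n <oo) ((lambda n)%:num^-1)%:E = +oo)%E ->
  generic [set F : S2 lambda | everywhere_locally_unbounded F].
Proof.
move=> loo.
(* Natural numbers encode two rational endpoints and an integer level; codes without a genuine
   interval give the empty set. *)
pose A n : set (S2 lambda) := if choice.unpickle n is Some (a, b, k) then
  if (a < b :> rat) then bounded_on ((@expi R) @` [set` `](ratr a), (ratr b)[]) (k : nat)%:R
  else set0 else set0.
exists A => [n|].
  have nd0 : nowhere_dense (set0 : set (S2 lambda)) by rewrite /nowhere_dense closure0 interior0.
  rewrite /A; case: choice.unpickle => [[[a b] k]|//].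
  case: ifP => // ab; apply: nowhere_dense_bounded_on => //.
  by exists (ratr a), (ratr b); rewrite ltr_rat.
apply/seteqP; split => [F /= nF|F [n _]]; last first.
  rewrite /A; case: choice.unpickle => [[[a b] k]|//].
  case: ifP => // ab bF uF.
  have aI : Defs.arc ((@expi R) @` [set` `](ratr a), (ratr b)[]).
    by exists (ratr a), (ratr b); rewrite ltr_rat.
  (* Unboundedness is tested at positive levels while k may be 0, hence the level k + 1. *)
  have k0 : (0 : R) < k.+1%:R by [].
  have := uF _ _ aI k0; apply/negP; rewrite -leNgt -bF; apply: le_measure; rewrite ?inE.
  - apply: measurableI; first exact: measurable_arc.
    by apply: measurable_superlevel; exact: S2_cmeasurable.
  - apply: measurableI; first exact: measurable_arc.
    by apply: measurable_superlevel; exact: S2_cmeasurable.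
  - move=> z [Iz /= kz]; split => //=; apply: le_lt_trans kz; by rewrite ler_nat.
have [I [M [aI M0 IF]]] : exists I M, [/\ Defs.arc I, 0 < M & bounded_on I M F].
  apply: contrapT => H; apply: nF => I M aI M0; rewrite lt0e measure_ge0 andbT.
  by apply/eqP => I0; apply: H; exists I, M; split.
have [a [b [ab IE]]] := aI.
(* Shrinking the arc to rational endpoints and raising the level to an integer preserves the
   bound. *)
have [q1] := rat_in_itvoo ab; rewrite in_itv/= => /andP[aq1 q1b].
have [q2] := rat_in_itvoo q1b; rewrite in_itv/= => /andP[q12 q2b].
have [k Mk] : exists k : nat, M <= k%:R by exists (Num.bound M); exact/ltW/archi_boundP/ltW.
exists (choice.pickle (q1, q2, k)); [by []|rewrite /A choice.pickleK].
have -> : q1 < q2 by rewrite -(ltr_rat R).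
apply/eqP; rewrite -measure_le0 -IF; apply: le_measure; rewrite ?inE.
- apply: measurableI; first by apply: measurable_arc; exists (ratr q1), (ratr q2).
  by apply: measurable_superlevel; exact: S2_cmeasurable.
- apply: measurableI; first exact: measurable_arc.
  by apply: measurable_superlevel; exact: S2_cmeasurable.
- move=> z [[t + <-] /= kz]; rewrite /= in_itv/= => /andP[t1 t2]; split => /=.
    by rewrite IE; exists t => //; rewrite /= in_itv/= (lt_trans aq1)//= (lt_trans t2).
  exact: le_lt_trans kz.
Qed.

End genericity.

Theorem theorem2p4 (R : realType) (lambda : nat -> {posnum R}) :
  ((exists f : S2 lambda, everywhere_locally_unbounded f) <->
   generic [set f : S2 lambda | everywhere_locally_unbounded f]) /\
  (generic [set f : S2 lambda | everywhere_locally_unbounded f] <->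
   (\sum_(0 <= n <oo) ((lambda n)%:num^-1)%:E = +oo)%E).
Proof.
have i_iii : (exists f : S2 lambda, everywhere_locally_unbounded f) ->
    (\sum_(0 <= n <oo) ((lambda n)%:num^-1)%:E = +oo)%E.
  move=> [f uf]; apply/eqP; rewrite -leye_eq leNgt; apply/negP => lfin.
  exact: not_everywhere_locally_unbounded lfin uf.
have iii_ii := @generic_everywhere_locally_unbounded R lambda.
have ii_i : generic [set f : S2 lambda | everywhere_locally_unbounded f] ->
    exists f : S2 lambda, everywhere_locally_unbounded f.
  move=> gen; apply: contrapT => /forallNP none; apply: (@S2_not_meager R lambda).
  by move: gen; congr meager; apply/seteqP; split=> // f _; exact: none.
split; first by split=> [/i_iii/iii_ii|/ii_i].
by split=> [/ii_i/i_iii|/iii_ii].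
Qed.
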